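(* Let $n\in\mathbb{N}^*$, $0\le\rho_1<\dots<\rho_n$, $\gamma_1,\dots,\gamma_n>0$, $x_0\ge0$, $a\ge 0$, $k\in\mathbb{R}$, $\sigma>0$. For $\mathbf{x}=(x^1,\dots,x^n)\in\mathbb{R}^n$ such that $x=x_0+\sum_{i=1}^n\gamma_ix^i\ge 0$ and $t\ge 0$, define $\psi_2(\mathbf{x},t,U)=A_{\mathbf{x}}(\varphi(x,t,U))$, with $\varphi$ the scheme given in the context. Then, for any $f\in\mathcal{C}^\infty_{\mathrm{pol}}(\mathbb{R}^n)$, there exist $C,E,\eta>0$ that only depend on a good sequence of $f$ such that for all $t\in(0,\eta)$ and all $\mathbf{x}\in\mathbb{R}^n$ with $x_0+\sum_{i=1}^n\gamma_ix^i\ge0$, $$\left|\mathbb{E}[f(\psi_2(\mathbf{x},t,U))]-f(\mathbf{x})-t\mathcal{L}_2f(\mathbf{x})-\frac{t^2}2\mathcal{L}_2^2f(\mathbf{x})\right|\le Ct^3(1+|\mathbf{x}|^E).$$ Let $\bar{\mathscr{C}}=\{\mathbf{x}\in\mathbb{R}^n:\ \forall t\ge0,\ x_0+\sum_{i=1}^n\gamma_ie^{-\rho_it}x^i\ge0\}$. For $\mathbf{x}\in\bar{\mathscr{C}}$ and $t\ge0$, define $$\Psi(\mathbf{x},t,U):=\psi_1(\psi_2(\psi_1(\mathbf{x},t/2),t,U),t/2).$$ Then, for any $f\in\mathcal{C}^\infty_{\mathrm{pol}}(\mathbb{R}^n)$, there exist $C,E,\eta>0$ that only depend on a good sequence of $f$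 such that for all $t\in(0,\eta)$ and all $\mathbf{x}\in\bar{\mathscr{C}}$, $$\left|\mathbb{E}[f(\Psi(\mathbf{x},t,U))]-f(\mathbf{x})-t\mathcal{L}f(\mathbf{x})-\frac{t^2}2\mathcal{L}^2f(\mathbf{x})\right|\le Ct^3(1+|\mathbf{x}|^E).$$
   Context: $\mathcal{C}^\infty_{\mathrm{pol}}(\mathbb{R}^n)$ is the set of $\mathcal{C}^\infty$ functions $f:\mathbb{R}^n\to\mathbb{R}$ such that for every multi-index $\alpha\in\mathbb{N}^n$ there exist $C_\alpha>0$, $e_\alpha\in\mathbb{N}^*$ with $|\partial_\alpha f(x)|\le C_\alpha(1+|x|^{e_\alpha})$ for all $x\in\mathbb{R}^n$; such a family $(C_\alpha,e_\alpha)_{\alpha}$ is called a good sequence for $f$. The constants $C,E,\eta$ may also depend on the fixed model parameters $n,\rho_i,\gamma_i,x_0,a,k,\sigma$. Let $G(t)=\sum_{i=1}^n\gamma_ie^{-\rho_it}$, so $G(0)=\sum_{i=1}^n\gamma_i$. With $x=x_0+\sum_{i=1}^n\gamma_ix^i$, the operators are $$\mathcal{L}_1f(\mathbf{x})=-\sum_{i=1}^n\rho_ix^i\partial_if(\mathbf{x}),\qquad \mathcal{L}_2f(\mathbf{x})=(a-kx)\sum_{i=1}^n\partial_if(\mathbf{x})+\frac{\sigma^2}{2}x\sum_{i,j=1}^n\partial_i\partial_jf(\mathbf{x}),\qquad \mathcal{L}=\mathcal{L}_1+\mathcal{L}_2.$$ (These are the generators of $dX^i_t=-\rho_iX^i_tdt$,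 of $dX^i_t=[a-kX_t]dt+\sigma\sqrt{X_t}dW_t$, and of $dX^i_t=-\rho_iX^i_tdt+[a-kX_t]dt+\sigma\sqrt{X_t}dW_t$, with $X_t=x_0+\sum_{i=1}^n\gamma_iX^i_t$ and $W$ a one-dimensional Brownian motion.) $\psi_1(\mathbf{x},t)=(x^1e^{-\rho_1t},\dots,x^ne^{-\rho_nt})$ and, for $y\in\mathbb{R}$, $A_{\mathbf{x}}(y)=\big(x^1+\frac{y-x}{G(0)},\dots,x^n+\frac{y-x}{G(0)}\big)$ with $x=x_0+\sum_{i=1}^n\gamma_ix^i$. Scheme $\varphi$: let $U$ be uniformly distributed on $[0,1]$, $\bar a=G(0)a$, $\bar k=G(0)k$, $\bar\sigma=G(0)\sigma$, $\zeta_\kappa(t)=\frac{1-e^{-\kappa t}}{\kappa}$ for $\kappa\ne0$ and $\zeta_0(t)=t$, $w(u)=\sqrt3(\mathbf{1}_{u>5/6}-\mathbf{1}_{u\le1/6})$, $$\bar u_1(t,x)=xe^{-\bar kt}+\bar a\zeta_{\bar k}(t),\qquad \bar u_2(t,x)=\bar u_1(t,x)^2+\bar\sigma^2\zeta_{\bar k}(t)\big[\bar a\zeta_{\bar k}(t)/2+xe^{-\bar kt}\big],$$ $$\pi(t,x)=\frac{1-\sqrt{1-\bar u_1(t,x)^2/\bar u_2(t,x)}}{2},$$ $$\bar{\mathbf{K}}_2(t)=\mathbf{1}_{\{\bar\sigma^2>4\bar a\}}e^{\frac{\bar kt}2}\left(\Big(\frac{\bar\sigma^2}4-\bar a\Big)\zeta_{\bar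 k}\Big(\frac t2\Big)+\left[\sqrt{e^{\frac{\bar kt}2}\Big(\frac{\bar\sigma^2}4-\bar a\Big)\zeta_{\bar k}\Big(\frac t2\Big)}+\frac{\bar\sigma}2\sqrt{3t}\right]^2\right).$$ For $x\ge0$ and $t\ge 0$: if $x\ge\bar{\mathbf{K}}_2(t)$, $$\varphi(x,t,U)=e^{-\frac{\bar kt}2}\left(\sqrt{\Big(\bar a-\frac{\bar\sigma^2}4\Big)\zeta_{\bar k}\Big(\frac t2\Big)+e^{-\frac{\bar kt}2}x}+\frac{\bar\sigma}2\sqrt t\,w(U)\right)^2+\Big(\bar a-\frac{\bar\sigma^2}4\Big)\zeta_{\bar k}\Big(\frac t2\Big),$$ and if $x<\bar{\mathbf{K}}_2(t)$, $$\varphi(x,t,U)=\mathbf{1}_{\{U\le\pi(t,x)\}}\frac{\bar u_1(t,x)}{2\pi(t,x)}+\mathbf{1}_{\{U>\pi(t,x)\}}\frac{\bar u_1(t,x)}{2(1-\pi(t,x))},$$ with the convention $\varphi(x,t,U)=0$ when $\bar u_1(t,x)=0$ in this second case. *)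

(* Defs.v *)
From HB Require Import structures.
From mathcomp Require Import all_boot all_order all_algebra.
From mathcomp Require Import all_classical all_reals all_analysis.
Import Order.TTheory GRing.Theory Num.Theory.
Import numFieldNormedType.Exports.

Set Implicit Arguments.
Unset Strict Implicit.
Unset Printing Implicit Defensive.

Local Open Scope classical_set_scope.
Local Open Scope ring_scope.

(* The library norm on row vectors is the sup norm. *)
Definition enorm (R : realType) (n : nat) (x : 'rV[R]_n) : R :=
  Num.sqrt (\sum_(i < n) x 0 i ^+ 2).

Definition partial (R : realType) (n : nat) (i : 'I_n) (f : 'rV[R]_n -> R) :
    'rV[R]_n -> R :=
  fun x => 'D_(delta_mx 0 i) f x.

(* All iterated partial derivatives, in any order of differentiation, exist
   and are continuous. *)
Definition smooth (R : realType) (n : nat) (f : 'rV[R]_n -> R) : Prop :=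
  forall s : seq 'I_n,
    let g := foldr (@partial R n) f s in
    continuous g /\
    forall (i : 'I_n) (x : 'rV[R]_n), derivable g x (delta_mx 0 i).

Definition mpartial (R : realType) (n : nat) (alpha : {ffun 'I_n -> nat})
    (f : 'rV[R]_n -> R) : 'rV[R]_n -> R :=
  foldr (fun i g => iter (alpha i) (partial i) g) f (enum 'I_n).

Definition good_sequence (R : realType) (n : nat)
    (C : {ffun 'I_n -> nat} -> R) (e : {ffun 'I_n -> nat} -> nat)
    (f : 'rV[R]_n -> R) : Prop :=
  forall alpha : {ffun 'I_n -> nat},
    [/\ 0 < C alpha, (0 < e alpha)%N &
        forall x : 'rV[R]_n,
          `|mpartial alpha f x| <= C alpha * (1 + enorm x ^+ e alpha)].

Definition Cinfpol (R : realType) (n : nat) : set ('rV[R]_n -> R) :=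
  [set f | smooth f /\ exists C e, good_sequence C e f].

Definition kernelG (R : realType) (n : nat) (rho gamma : 'I_n -> R) (t : R) : R :=
  \sum_(i < n) gamma i * expR (- rho i * t).

Definition agg (R : realType) (n : nat) (gamma : 'I_n -> R) (x0 : R)
    (x : 'rV[R]_n) : R :=
  x0 + \sum_(i < n) gamma i * x 0 i.

Definition L1 (R : realType) (n : nat) (rho : 'I_n -> R)
    (f : 'rV[R]_n -> R) : 'rV[R]_n -> R :=
  fun x => - \sum_(i < n) rho i * x 0 i * partial i f x.

Definition L2 (R : realType) (n : nat) (gamma : 'I_n -> R) (x0 a k sigma : R)
    (f : 'rV[R]_n -> R) : 'rV[R]_n -> R :=
  fun x =>
    (a - k * agg gamma x0 x) * (\sum_(i < n) partial i f x) +
    sigma ^+ 2 / 2 * agg gamma x0 x *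
      (\sum_(i < n) \sum_(j < n) partial i (partial j f) x).

Definition Lgen (R : realType) (n : nat) (rho gamma : 'I_n -> R)
    (x0 a k sigma : R) (f : 'rV[R]_n -> R) : 'rV[R]_n -> R :=
  fun x => L1 rho f x + L2 gamma x0 a k sigma f x.

Definition psi1 (R : realType) (n : nat) (rho : 'I_n -> R)
    (x : 'rV[R]_n) (t : R) : 'rV[R]_n :=
  \row_(i < n) (x 0 i * expR (- rho i * t)).

Definition Amap (R : realType) (n : nat) (rho gamma : 'I_n -> R) (x0 : R)
    (x : 'rV[R]_n) (y : R) : 'rV[R]_n :=
  \row_(i < n) (x 0 i + (y - agg gamma x0 x) / kernelG rho gamma 0).

(* The one-dimensional CIR scheme; its parameters [a k s] are to be
   instantiated with the rescaled ones, G(0) a, G(0) k and G(0) sigma. *)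

Definition zeta (R : realType) (kappa t : R) : R :=
  if kappa == 0 then t else (1 - expR (- kappa * t)) / kappa.

Definition wstep (R : realType) (u : R) : R :=
  Num.sqrt 3 * ((5 / 6 < u)%R%:R - (u <= 1 / 6)%R%:R).

Definition cir_u1 (R : realType) (a k t x : R) : R :=
  x * expR (- k * t) + a * zeta k t.

Definition cir_u2 (R : realType) (a k s t x : R) : R :=
  cir_u1 a k t x ^+ 2 +
  s ^+ 2 * zeta k t * (a * zeta k t / 2 + x * expR (- k * t)).

Definition cir_pi (R : realType) (a k s t x : R) : R :=
  (1 - Num.sqrt (1 - cir_u1 a k t x ^+ 2 / cir_u2 a k s t x)) / 2.

Definition cir_K2 (R : realType) (a k s t : R) : R :=
  (4 * a < s ^+ 2)%R%:R * expR (k * t / 2) *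
  ((s ^+ 2 / 4 - a) * zeta k (t / 2) +
   (Num.sqrt (expR (k * t / 2) * ((s ^+ 2 / 4 - a) * zeta k (t / 2))) +
    s / 2 * Num.sqrt (3 * t)) ^+ 2).

Definition cir_phi (R : realType) (a k s x t u : R) : R :=
  if cir_K2 a k s t <= x then
    expR (- (k * t) / 2) *
      (Num.sqrt ((a - s ^+ 2 / 4) * zeta k (t / 2) + expR (- (k * t) / 2) * x) +
       s / 2 * Num.sqrt t * wstep u) ^+ 2 +
    (a - s ^+ 2 / 4) * zeta k (t / 2)
  else if cir_u1 a k t x == 0 then 0
  else
    (u <= cir_pi a k s t x)%R%:R *
      (cir_u1 a k t x / (2 * cir_pi a k s t x)) +
    (cir_pi a k s t x < u)%R%:R *
      (cir_u1 a k t x / (2 * (1 - cir_pi a k s t x))).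

Definition psi2 (R : realType) (n : nat) (rho gamma : 'I_n -> R)
    (x0 a k sigma : R) (x : 'rV[R]_n) (t u : R) : 'rV[R]_n :=
  let G0 := kernelG rho gamma 0 in
  Amap rho gamma x0 x
    (cir_phi (G0 * a) (G0 * k) (G0 * sigma) (agg gamma x0 x) t u).

Definition Psi (R : realType) (n : nat) (rho gamma : 'I_n -> R)
    (x0 a k sigma : R) (x : 'rV[R]_n) (t u : R) : 'rV[R]_n :=
  psi1 rho
    (psi2 rho gamma x0 a k sigma (psi1 rho x (t / 2)) t u)
    (t / 2).

Definition coneC (R : realType) (n : nat) (rho gamma : 'I_n -> R) (x0 : R) :
    set 'rV[R]_n :=
  [set x | forall t : R, 0 <= t ->
     0 <= x0 + \sum_(i < n) gamma i * expR (- rho i * t) * x 0 i].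

Definition uniform01 (R : realType) (d : measure_display)
    (Omega : measurableType d) (P : probability Omega R) (U : {RV P >-> R}) :
    Prop :=
  forall A : set R, measurable A ->
    distribution P U A = uniform_prob (@ltr01 R) A.

(* With [S x t u] the value at time [t] of a scheme started at [x] and driven
   by [u], and [M] an operator on functions, the remainder of the second-order
   expansion of E[f (S x t U)] is at most C t^3 (1 + |x|^E), for x in the
   domain [D]. The constants C, E, eta are chosen before the test function: they
   depend only on the good sequence (Cf, ef), and not on the probability space
   carrying U either. *)
Definition second_order_scheme (R : realType) (n : nat)
    (D : set 'rV[R]_n) (S : 'rV[R]_n -> R -> R -> 'rV[R]_n)
    (M : ('rV[R]_n -> R) -> ('rV[R]_n -> R)) : Prop :=
  forall (Cf : {ffun 'I_n -> nat} -> R) (ef : {ffun 'I_n -> nat} -> nat),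
  exists C E eta : R,
    [/\ 0 < C, 0 < E, 0 < eta &
    forall f : 'rV[R]_n -> R, Cinfpol f -> good_sequence Cf ef f ->
    forall (d : measure_display) (Omega : measurableType d)
      (P : probability Omega R) (U : {RV P >-> R}), uniform01 U ->
    forall (t : R) (x : 'rV[R]_n), 0 < t -> t < eta -> D x ->
      (`| 'E_P[(fun w => f (S x t (U w)))] -
          (f x + t * M f x + t ^+ 2 / 2 * M (M f) x)%:E |
       <= (C * t ^+ 3 * (1 + enorm x `^ E))%:E)%E].

(* Main.v *)
(**
   Along the line [y |-> A_x(y)] the operator [L_2] is the generator
   [(a - k y) g' + s^2/2 y g''] of a one-dimensional CIR process with rescaled
   parameters, so the first estimate is one-dimensional. At fixed [t] and [x] the
   scheme takes at most three values; Taylor's formula of order six reduces the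
   claim to matching E[(Y - x)^j], j = 1..6, with the moments prescribed by the
   generator up to O(t^3). Above the threshold the moments are polynomials in
   [exp(-kt/2)], [zeta_k(t/2)], [t] and [x], and second-order expansions in [t]
   multiply like truncated polynomials. Below it [x = O(t)] and [Y = O(t)], hence
   only the first two moments matter, and these are exact.

   For the composed scheme, [P_s f = f o psi_1(., s)] satisfies
   [P_s = 1 + s L_1 + s^2/2 L_1^2 + O(s^3)], and
   [P_(t/2) (1 + t L_2 + t^2/2 L_2^2) P_(t/2)] agrees with
   [1 + t (L_1 + L_2) + t^2/2 (L_1 + L_2)^2] up to O(t^3).
   The remainders [(P_s f - f) / s] and [(P_s f - f - s L_1 f) / s^2] stay,
   uniformly in [s], in the class of functions whose derivatives of all orders
   grow polynomially, and this class is stable under [L_1], [L_2] and [P_s].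
*)
Require Import Defs.
From HB Require Import structures.
From mathcomp Require Import all_boot all_order all_algebra.
From mathcomp Require Import all_classical all_reals all_analysis.
From mathcomp Require Import ring lra.
Import Order.TTheory GRing.Theory Num.Theory.
Import numFieldNormedType.Exports.

Set Implicit Arguments.
Unset Strict Implicit.
Unset Printing Implicit Defensive.

Local Open Scope classical_set_scope.
Local Open Scope ring_scope.

(** * Calculus in one and several variables *)

(** The constants must be uniform over all [f] with the same good sequence; moreover, in the
    composed scheme the inner estimate is applied to [f o psi_1(., t/2)], a test function that
    itself moves with [t]. Hence bounds are proved for indexed families, and the step size is later
    made part of the index. Smoothness is given by iterated partial derivatives only, so the chain
    rule along curves and the symmetry of mixed derivatives are derived from the mean value theorem.
    Order six in Taylor's formula comes from [Y - x] being of size [sqrt t]: the sixth moment is the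
    first even one of order [t^3], and an even power needs no absolute value. Half-integer powers of
    [t] do not appear in the moments, because the weight is symmetric and only even powers of the
    square root survive averaging. In the splitting the remainders stand under [L_1] and [L_2], so
    their space derivatives must be bounded uniformly in the step. Differentiating a remainder gives
    remainders of derivatives plus terms with bounded coefficients, thanks to the commutator of a
    partial derivative with [L_1]. *)

Lemma MVT_scaled (R : realType) (f df : R -> R) (s : R) :
  (forall x : R, is_derive x 1 f (df x)) ->
  exists2 u, 0 <= u <= 1 & f s - f 0 = s * df (u * s).
Proof.
move=> fd.
have cf a b : {within `[a, b], continuous f}.
  apply: continuous_subspaceT => x; apply: differentiable_continuous.
  by apply/derivable1_diffP; apply: ex_derive.
have [s0|s0|->] := ltgtP s 0; last first.
- by exists 0; rewrite ?lexx ?ler01// subrr mul0r.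
- have [c cab e] := MVT_segment (ltW s0) (fun x _ => fd x) (cf _ _).
  exists (c / s); last by rewrite e subr0 mulrC divfK// gt_eqF.
  move: cab; rewrite in_itv /= => /andP[c0 cs].
  by rewrite ler_pdivlMr// mul0r c0 ler_pdivrMr// mul1r.
- have [c cab e] := MVT_segment (ltW s0) (fun x _ => fd x) (cf _ _).
  exists (c / s); last first.
    by rewrite divfK ?lt_eqF// -[LHS]opprB e sub0r mulrN opprK mulrC.
  move: cab; rewrite in_itv /= => /andP[c0 cs].
  by rewrite ler_ndivlMr// mul0r cs ler_ndivrMr// mul1r.
Qed.

Lemma is_derive_taylor_sum (R : realType) (n : nat) (c : nat -> R) (y : R) :
  is_derive y 1 (fun y => \sum_(j < n.+1) c j * (y ^+ j / j`!%:R))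
    (\sum_(j < n) c j.+1 * (y ^+ j / j`!%:R)).
Proof.
elim: n => [|n IH].
  rewrite big_ord0 (_ : (fun _ => _) = cst (c 0%N)); first exact: is_derive_cst.
  by apply/funext => z; rewrite big_ord1 expr0 fact0 divr1 mulr1.
rewrite (_ : (fun _ => _) = (fun y => \sum_(j < n.+1) c j * (y ^+ j / j`!%:R)) +
    (c n.+1 / n.+1`!%:R) *: (@id R) ^+ n.+1); last first.
  apply/funext => z; rewrite big_ord_recr /= fctE; congr (_ + _).
  rewrite !fctE /GRing.scale /=.
  by rewrite mulrA mulrAC.
rewrite big_ord_recr /=; apply: is_deriveD.
apply: is_derive_eq.
rewrite /GRing.scale /= mulr1 factS natrM.
have : (n.+1%:R : R) != 0 by rewrite pnatr_eq0.
have : (n`!%:R : R) != 0 by rewrite pnatr_eq0 -lt0n fact_gt0.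
move: (n.+1%:R : R) (n`!%:R : R) => u v v0 u0.
by field; rewrite u0 v0.
Qed.

(** The remainder, as a function of the increment, has for derivative the remainder of one order
    less for the shifted sequence. One mean value step brings out a factor [h], and the induction
    hypothesis applies at [u * h]. The factor [1/n!] is given up, since only orders of magnitude
    matter. *)
Lemma taylor_bound (R : realType) (n : nat) (g : nat -> R -> R) (x h M : R) :
  (forall j (y : R), is_derive y 1 (g j) (g j.+1 y)) ->
  (forall u, 0 <= u <= 1 -> `|g n (x + u * h)| <= M) ->
  `|g 0 (x + h) - \sum_(j < n) g j x * (h ^+ j / j`!%:R)| <= M * `|h| ^+ n.
Proof.
elim: n g h => [|n IH] g h gd gM.
  rewrite big_ord0 subr0 expr0 mulr1.
  by have := gM 1; rewrite mul1r ler01 lexx; apply.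
pose r (y : R) := g 0%N (x + y) - \sum_(j < n.+1) g j x * (y ^+ j / j`!%:R).
pose dr (y : R) := g 1%N (x + y) - \sum_(j < n) g j.+1 x * (y ^+ j / j`!%:R).
have rd (y : R) : is_derive y 1 r (dr y).
  have d1 : is_derive y 1 (fun y => g 0%N (x + y)) (g 1%N (x + y)).
    have dx : is_derive y 1 (fun y : R => x + y) 1.
      have := is_deriveD (is_derive_cst x y 1) (is_derive_id y 1).
      by rewrite add0r.
    have := @is_derive1_comp _ (g 0%N) (fun y => x + y) y _ _ (gd _ _) dx.
    by rewrite mulr1.
  have H := is_deriveB d1 (is_derive_taylor_sum n (fun j => g j x) y).
  rewrite /r /dr; exact: H.
have [u /andP[u0 u1] e] := MVT_scaled h rd.
have r0 : r 0 = 0.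
  rewrite /r addr0 big_ord_recl expr0 fact0 divr1 mulr1.
  rewrite big1 ?addr0 ?subrr// => i _.
  by rewrite /= /bump leq0n add1n expr0n mul0r mulr0.
have -> : g 0%N (x + h) - \sum_(j < n.+1) g j x * (h ^+ j / j`!%:R) = h * dr (u * h).
  by rewrite -e r0 subr0.
rewrite normrM exprS mulrCA ler_wpM2l//.
apply: (le_trans (IH (fun j => g j.+1) (u * h) _ _)) => //.
- move=> v /andP[v0 v1]; rewrite mulrA; apply: gM.
  by rewrite mulr_ge0//= mulr_ile1.
- rewrite ler_wpM2l//.
    by apply: le_trans (gM 0 _); rewrite ?mul0r ?addr0 ?lexx ?ler01.
  rewrite normrM ger0_norm// exprMn ler_piMl ?exprn_ge0//.
  by rewrite exprn_ile1.
Qed.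

Lemma derivable_line (R : realType) (n : nat) (f : 'rV[R]_n -> R) v (y : 'rV[R]_n) (s : R) :
  derivable f (y + s *: v) v ->
  is_derive s 1 (fun s => f (y + s *: v)) ('D_v f (y + s *: v)).
Proof.
have E : (fun h : R => h^-1 *: (((fun s => f (y + s *: v)) \o shift s) (h *: 1) - f (y + s *: v))) =
   (fun h => h^-1 *: ((f \o shift (y + s *: v)) (h *: v) - f (y + s *: v))).
  apply/funext => h /=; congr (_ *: (f _ - _)).
  by rewrite [h%:A]mulr1 scalerDl addrCA.
move=> fd; apply: DeriveDef.
  by rewrite /derivable E.
by rewrite /derive E.
Qed.

Lemma mvt_coord (R : realType) (n : nat) (f : 'rV[R]_n -> R) v (y : 'rV[R]_n) (s : R) :
  (forall x, derivable f x v) ->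
  exists2 r, `|r| <= `|s| & f (y + s *: v) - f y = s * 'D_v f (y + r *: v).
Proof.
move=> fd.
have [u /andP[u0 u1] e] := MVT_scaled s (fun x => @derivable_line _ _ f v y x (fd _)).
exists (u * s); last by rewrite -e scale0r addr0.
by rewrite normrM ger0_norm// ler_piMl.
Qed.

Lemma rV_norm_le (R : realType) (n : nat) (v : 'rV[R]_n) (e : R) :
  0 <= e -> (forall j, `|v 0 j| <= e) -> `|v| <= e.
Proof.
move=> e0 ve; rewrite /Num.Def.normr/= mx_normrE (bigmax_le _ e0)//= => -[i j] _ /=.
by rewrite (ord1 i); exact: ve.
Qed.

Lemma coord_le_norm (R : realType) (n : nat) (v : 'rV[R]_n) j : `|v 0 j| <= `|v|.
Proof.
by rewrite [leRHS]/Num.Def.normr/= mx_normrE; exact: (le_bigmax _ _ (0, j)).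
Qed.

Lemma cvg_is_derive (R : realType) (V : normedModType R) (f : R -> V) (t : R) (l : V) :
  (h^-1 *: (f (h + t) - f t) @[h --> 0^'] --> l) -> is_derive t 1 f l.
Proof.
have -> : (fun h => h^-1 *: (f (h + t) - f t)) =
   (fun h : R => h^-1 *: ((f \o shift t) (h *: 1) - f t)).
  by apply/funext => h /=; rewrite [h%:A]mulr1.
move=> H; apply: DeriveDef; first by apply/cvg_ex; exists l.
by apply/cvg_lim.
Qed.

Lemma is_derive_cvg (R : realType) (V : normedModType R) (f : R -> V) (t : R) (l : V) :
  is_derive t 1 f l -> (h^-1 *: (f (h + t) - f t) @[h --> 0^'] --> l).
Proof.
have -> : (fun h => h^-1 *: (f (h + t) - f t)) =
   (fun h : R => h^-1 *: ((f \o shift t) (h *: 1) - f t)).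
  by apply/funext => h /=; rewrite [h%:A]mulr1.
by move=> [fd <-]; exact: fd.
Qed.

Lemma cvg_dist_le (R : realType) (T : Type) (F : set_system T) (FF : Filter F)
    (V W : normedModType R) (g : T -> V) (h : T -> W) (l : V) (m : W) :
  (forall x, `|h x - m| <= `|g x - l|) -> g @ F --> l -> h @ F --> m.
Proof.
move=> hg /cvgrPdist_le gl; apply/cvgrPdist_le => e e0.
apply: filterS (gl e e0) => x.
by rewrite distrC => xe; rewrite distrC (le_trans (hg x)).
Qed.

(** Each increment of one coordinate is a partial derivative at an intermediate point; these points
    are squeezed towards [c t], where the partial derivatives are continuous. *)
Lemma is_derive_curve (R : realType) (n : nat) (f : 'rV[R]_n -> R)
    (c : R -> 'rV[R]_n) (dc : 'rV[R]_n) (t : R) :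
  (forall i x, derivable f x (delta_mx 0 i)) ->
  (forall i, continuous (partial i f)) ->
  (forall i, is_derive t 1 (fun s => c s 0 i) (dc 0 i)) ->
  is_derive t 1 (f \o c) (\sum_(i < n) dc 0 i * partial i f (c t)).
Proof.
move=> fd fc cd.
have cc : c (h + t) @[h --> 0^'] --> c t.
  have /derivable1_diffP/differentiable_continuous : derivable c t 1.
    by apply/derivable_mxP => i j; rewrite (ord1 i); apply: ex_derive.
  move=> ct.
  have ht : h + t @[h --> (0:R)^'] --> t.
    rewrite -[X in _ --> X]add0r; apply: cvgD; last exact: cvg_cst.
    exact: nbhs_dnbhs.
  exact: (cvg_comp _ _ ht ct).
(* [mix] moves the coordinates from [c t] to [c (h + t)] one at a time. *)
pose mix (k : nat) (h : R) : 'rV[R]_n :=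
  \row_j (if (j < k)%N then c (h + t) 0 j else c t 0 j).
have step (k : 'I_n) (h : R) : exists xi : 'rV[R]_n, `|xi - c t| <= `|c (h + t) - c t| /\
    f (mix k.+1 h) - f (mix k h) = (c (h + t) 0 k - c t 0 k) * partial k f xi.
  have [r rs e] := mvt_coord (mix k h) (c (h + t) 0 k - c t 0 k) (fd k).
  exists (mix k h + r *: delta_mx 0 k); split; last first.
    rewrite -e; congr (f _ - _); apply/rowP => j; rewrite !mxE eqxx /= ltnS leq_eqVlt.
    case: (eqVneq j k) => [->|jk] /=.
      by rewrite eqxx ltnn /= mulr1 addrC subrK.
    by rewrite mulr0 addr0 (inj_eq val_inj) (negbTE jk).
  apply: rV_norm_le => // j; rewrite !mxE eqxx /=.
  apply: (@le_trans _ _ `|c (h + t) 0 j - c t 0 j|); last first.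
    by have := coord_le_norm (c (h + t) - c t) j; rewrite !mxE.
  case: (eqVneq j k) => [->|jk] /=.
    by rewrite ltnn mulr1 addrAC subrr add0r.
  by rewrite mulr0 addr0; case: ifP => // _; rewrite subrr normr0.
(* The intermediate points must be functions of [h] before a limit in [h] can be taken. *)
have [xi xiP] := choice (fun p : 'I_n * R => step p.1 p.2).
apply: cvg_is_derive.
have -> : (fun h => h^-1 *: ((f \o c) (h + t) - (f \o c) t)) =
   (fun h => \sum_(k < n) (h^-1 *: (c (h + t) 0 k - c t 0 k)) * partial k f (xi (k, h))).
  apply/funext => h /=.
  have cn : c (h + t) = mix n h by apply/rowP => j; rewrite !mxE ltn_ord.
  have c0 : c t = mix 0%N h by apply/rowP => j; rewrite !mxE.
  have -> : f (c (h + t)) - f (c t) = f (mix n h) - f (mix 0%N h).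
    by rewrite -cn -c0.
  rewrite -(telescope_sumr (fun k => f (mix k h)) (leq0n n)).
  rewrite big_mkord scaler_sumr.
  by apply: eq_bigr => k _; rewrite (xiP (k, h)).2 scalerAl.
apply: cvg_big => [|k _]; first exact: add_continuous.
apply: cvgM; first exact: is_derive_cvg.
have xic : xi (k, h) @[h --> 0^'] --> c t.
  by apply: (cvg_dist_le _ _ cc) => h; exact: (xiP (k, h)).1.
by apply: (cvg_comp _ _ xic); exact: fc.
Qed.

Lemma derive_translate (R : realType) (n : nat) (f : 'rV[R]_n -> R) (w v x : 'rV[R]_n) :
  derivable f (x + w) v ->
  is_derive x v (fun y => f (y + w)) ('D_v f (x + w)).
Proof.
have E : (fun h : R => h^-1 *: (((fun y => f (y + w)) \o shift x) (h *: v) - f (x + w))) =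
   (fun h => h^-1 *: ((f \o shift (x + w)) (h *: v) - f (x + w))).
  by apply/funext => h /=; rewrite addrA.
move=> fd; apply: DeriveDef.
  by rewrite /derivable E.
by rewrite /derive E.
Qed.

(** The second difference of [f] over a square of side [h] is symmetric in the two directions. Two
    mean value steps, taken in either order, write it as [h^2] times one or the other mixed
    derivative at a point within [2 |h|] of [x]; dividing by [h^2] and letting [h] tend to 0
    identifies them. *)
Lemma clairaut (R : realType) (n : nat) (f : 'rV[R]_n -> R) (i j : 'I_n) :
  (forall x, derivable f x (delta_mx 0 i)) ->
  (forall x, derivable f x (delta_mx 0 j)) ->
  (forall x, derivable (partial j f) x (delta_mx 0 i)) ->
  (forall x, derivable (partial i f) x (delta_mx 0 j)) ->
  continuous (partial i (partial j f)) -> continuous (partial j (partial i f)) ->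
  partial i (partial j f) = partial j (partial i f).
Proof.
move=> di dj dij dji cij cji; apply/funext => x.
have main a b (h : R) : (forall x, derivable f x (delta_mx 0 a)) ->
  (forall x, derivable (partial a f) x (delta_mx 0 b)) ->
  exists2 xi, `|xi - x| <= 2 * `|h| &
   (f (x + h *: delta_mx 0 a + h *: delta_mx 0 b) - f (x + h *: delta_mx 0 a))
   - (f (x + h *: delta_mx 0 b) - f x) = h * (h * partial b (partial a f) xi).
  move=> da dab.
  have du (y : 'rV[R]_n) := is_deriveB (derive_translate (da (y + h *: delta_mx 0 b))) (derivableP (da y)).
  have [r rs e] := mvt_coord x h (fun y => @ex_derive _ _ _ _ _ _ _ (du y)).
  have [r' rs' e'] := mvt_coord (x + r *: delta_mx 0 a) h dab.
  exists (x + r *: delta_mx 0 a + r' *: delta_mx 0 b).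
    rewrite addrC !addrA addNr add0r (le_trans (ler_normD _ _))// mulr_natl mulr2n.
    have dn k (s : R) : `|s *: (delta_mx 0 k : 'rV[R]_n)| <= `|s|.
      apply: rV_norm_le => // l; rewrite !mxE eqxx /=.
      by case: eqP => _; rewrite ?mulr1 // mulr0 normr0.
    by apply: lerD; [exact: le_trans rs|exact: le_trans rs'].
  rewrite -e'.
  have [_ E] := du (x + r *: delta_mx 0 a).
  move: e; rewrite E => <-.
  by [].
have main' a b (da : forall x, derivable f x (delta_mx 0 a))
    (dab : forall x, derivable (partial a f) x (delta_mx 0 b)) (h : R) :
   exists z, `|z - x| <= 2 * `|h| /\
   (f (x + h *: delta_mx 0 a + h *: delta_mx 0 b) - f (x + h *: delta_mx 0 a))
   - (f (x + h *: delta_mx 0 b) - f x) = h * (h * partial b (partial a f) z).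
  by have [z z1 z2] := main a b h da dab; exists z.
have [xi xiP] := choice (main' _ _ dj dij).
have [xj xjP] := choice (main' _ _ di dji).
have h0 : 2 * h @[h --> (0:R)^'] --> (2 * 0 : R).
  by apply: cvgM; [exact: cvg_cst|exact: nbhs_dnbhs].
have xc (z : R -> 'rV[R]_n) : (forall h, `|z h - x| <= 2 * `|h|) ->
    z h @[h --> (0:R)^'] --> x.
  move=> zx; apply: (cvg_dist_le _ _ h0) => h.
  by rewrite mulr0 subr0 normrM ger0_norm//.
have ci := cvg_comp _ _ (xc _ (fun h => (xiP h).1)) (cij x).
have cj := cvg_comp _ _ (xc _ (fun h => (xjP h).1)) (cji x).
apply/subr0_eq.
have c := cvgB ci cj.
have c' : (((partial i (partial j f) \o xi) - (partial j (partial i f) \o xj)) @ (0:R)^' --> (0 : R)).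
  apply: cvg_near_cst; near=> h.
  have hn0 : h != 0 by near: h; exact: nbhs_dnbhs_neq.
  apply/eqP; rewrite subr_eq0; apply/eqP.
  apply: (mulfI hn0); apply: (mulfI hn0) => /=.
  apply: (etrans (esym (xiP h).2)); apply: (etrans _ (xjP h).2).
  rewrite (addrAC x (h *: delta_mx 0 j) (h *: delta_mx 0 i)).
  by move: (f _) (f _) (f _) (f x) => u v w z; ring.
by rewrite -(cvg_lim _ (c _))// (cvg_lim _ c').
Unshelve. all: by end_near. Qed.

(** * Families of functions with uniformly polynomially bounded derivatives *)

(** The weight [(1 + |x|)^m], in the sup norm, is multiplicative and nondecreasing in [m], so sums
    and products keep this form. *)
Definition growth (R : realType) (n : nat) (I : Type) (F : I -> 'rV[R]_n -> R) :=
  exists C m, 0 <= C /\ forall i x, `|F i x| <= C * (1 + `|x|) ^+ m.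

(* Families stand for sets of test functions: the bounds are uniform in the index,
   which is how constants depend on a good sequence only. *)
Fixpoint tameN (R : realType) (n : nat) (I : Type) (N : nat)
    (F : I -> 'rV[R]_n -> R) : Prop :=
  [/\ growth F, forall i, continuous (F i) &
    if N is N'.+1 then
      (forall i j x, derivable (F i) x (delta_mx 0 j)) /\
      (forall j, tameN N' (fun i => partial j (F i)))
    else True].

Definition tame (R : realType) (n : nat) (I : Type) (F : I -> 'rV[R]_n -> R) :=
  forall N, tameN N F.

Lemma tame_growth (R : realType) n I (F : I -> 'rV_n -> R) : @tame R n I F -> growth F.
Proof. by move=> /(_ 0%N) []. Qed.

Lemma tame_continuous (R : realType) n I (F : I -> 'rV_n -> R) i : @tame R n I F -> continuous (F i).
Proof. by move=> /(_ 0%N) []. Qed.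

Lemma tame_derivable (R : realType) n I (F : I -> 'rV_n -> R) i j x :
  @tame R n I F -> derivable (F i) x (delta_mx 0 j).
Proof. by move=> /(_ 1%N) [_ _ []]. Qed.

Lemma tame_partial (R : realType) n I (F : I -> 'rV_n -> R) j :
  @tame R n I F -> tame (fun i => partial j (F i)).
Proof. by move=> Ft N; have [_ _ [_ pF]] := Ft N.+1; exact: pF. Qed.

Lemma tameN_S (R : realType) n I N (F : I -> 'rV_n -> R) : @tameN R n I N.+1 F -> tameN N F.
Proof.
elim: N F => [|N IH] F [gF cF [dF pF]]; split => //; split => // j.
exact: IH (pF j).
Qed.

Lemma eq_tame (R : realType) n I (F G : I -> 'rV_n -> R) :
  (forall i x, F i x = G i x) -> @tame R n I F -> tame G.
Proof. by move=> FG; rewrite (_ : F = G)//; apply/funext => i; apply/funext. Qed.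

Lemma growthD (R : realType) n I (F G : I -> 'rV_n -> R) :
  @growth R n I F -> growth G -> growth (fun i x => F i x + G i x).
Proof.
move=> [C [m [C0 FC]]] [D [p [D0 GD]]]; exists (C + D), (m + p)%N; split.
  exact: addr_ge0.
move=> i x; apply: le_trans (ler_normD _ _) _.
have w1 : 1 <= 1 + `|x| by rewrite lerDl.
rewrite mulrDl; apply: lerD.
  apply: le_trans (FC i x) _; rewrite ler_wpM2l// ler_weXn2l// leq_addr//.
by apply: le_trans (GD i x) _; rewrite ler_wpM2l// ler_weXn2l// leq_addl.
Qed.

Lemma growthM (R : realType) n I (F G : I -> 'rV_n -> R) :
  @growth R n I F -> growth G -> growth (fun i x => F i x * G i x).
Proof.
move=> [C [m [C0 FC]]] [D [p [D0 GD]]]; exists (C * D), (m + p)%N; split.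
  exact: mulr_ge0.
move=> i x; rewrite normrM exprD mulrACA.
by apply: ler_pM.
Qed.

Lemma tameND (R : realType) n I N (F G : I -> 'rV_n -> R) :
  @tameN R n I N F -> tameN N G -> tameN N (fun i x => F i x + G i x).
Proof.
elim: N F G => [|N IH] F G [gF cF dF] [gG cG dG]; split.
- exact: growthD.
- by move=> i x; apply: continuousD; [exact: cF|exact: cG].
- by [].
- exact: growthD.
- by move=> i x; apply: continuousD; [exact: cF|exact: cG].
- split => [i j x|j].
    by apply: (@derivableD _ _ _ (F i) (G i)); [exact: dF.1|exact: dG.1].
  have := IH _ _ (dF.2 j) (dG.2 j).
  congr (tameN N _); apply/funext => i; apply/funext => x.
  by rewrite /partial (@deriveD _ _ _ (F i) (G i))//; [exact: dF.1|exact: dG.1].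
Qed.

Lemma tameNM (R : realType) n I N (F G : I -> 'rV_n -> R) :
  @tameN R n I N F -> tameN N G -> tameN N (fun i x => F i x * G i x).
Proof.
elim: N F G => [|N IH] F G TF TG; have [gF cF dF] := TF; have [gG cG dG] := TG; split.
- exact: growthM.
- by move=> i x; apply: continuousM; [exact: cF|exact: cG].
- by [].
- exact: growthM.
- by move=> i x; apply: continuousM; [exact: cF|exact: cG].
- split => [i j x|j].
    by apply: (@derivableM _ _ (F i) (G i)); [exact: dF.1|exact: dG.1].
  (* The product rule pairs an undifferentiated factor with a differentiated one, so the former is
     first lowered to order [N]. *)
  have := tameND (IH _ _ (tameN_S TF) (dG.2 j)) (IH _ _ (tameN_S TG) (dF.2 j)).
  congr (tameN N _); apply/funext => i; apply/funext => x.
  by rewrite /partial (@deriveM _ _ (F i) (G i))//; [exact: dF.1|exact: dG.1].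
Qed.

(** The constant may vary with the index: step-dependent coefficients such as
    [(exp(- rho s) - 1) / s] enter in this form. *)
Lemma tame_cst (R : realType) n I (c : I -> R) (K : R) :
  (forall i, `|c i| <= K) -> @tame R n I (fun i _ => c i).
Proof.
move=> cK N; elim: N c K cK => [|N IH] c K cK.
  split; [|by move=> i; exact: cst_continuous|by []].
  exists `|K|, 0%N; split => // i x.
  by rewrite expr0 mulr1; exact: le_trans (ler_norm _).
split; last split => [i j x|j].
- exists `|K|, 0%N; split => // i x.
  by rewrite expr0 mulr1; exact: le_trans (ler_norm _).
- by move=> i; exact: cst_continuous.
- exact: derivable_cst.
- have := IH (fun=> 0) 0 _.
  rewrite normr0 => /(_ (fun=> lexx _)).
  congr (tameN N _); apply/funext => i; apply/funext => x.
  by rewrite /partial derive_cst.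
Qed.

Lemma is_derive_coord (R : realType) (n : nat) (j k : 'I_n) (x : 'rV[R]_n) :
  is_derive x (delta_mx 0 k) (fun x : 'rV[R]_n => x 0 j) ((k == j)%:R).
Proof.
have d := @differentiable_coord R 1 n x 0 j.
apply: DeriveDef; first exact: diff_derivable.
have E : (fun h : R => h^-1 *: (((fun x : 'rV[R]_n => x 0 j) \o shift x) (h *: delta_mx 0 k) - x 0 j)) @ 0^' --> ((k == j)%:R : R).
  apply: cvg_near_cst; near=> h.
  have h0 : h != 0 by near: h; exact: nbhs_dnbhs_neq.
  rewrite /= !mxE eqxx /= addrK scalerA mulVf// eq_sym; exact: mul1r.
exact: (cvg_lim _ E).
Unshelve. all: by end_near. Qed.

Lemma tame_coord (R : realType) n I (j : 'I_n) : @tame R n I (fun _ x => x 0 j).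
Proof.
move=> N.
have g : @growth R n I (fun _ x => x 0 j).
  exists 1, 1%N; split => // i x; rewrite mul1r expr1.
  by apply: le_trans (coord_le_norm x j) _; rewrite lerDr.
have c : I -> continuous (fun x : 'rV[R]_n => x 0 j).
  by move=> i; exact: coord_continuous.
case: N => [|N]; split => //; split => [i k x|k].
  exact: @ex_derive _ _ _ _ _ _ _ (is_derive_coord j k x).
have := @tame_cst R n I (fun=> (k == j)%:R) 1 _ N.
rewrite (_ : (fun i => partial k _) = (fun i _ => (k == j)%:R)).
  by apply => i; case: eqP; rewrite ?normr1 ?normr0.
apply/funext => i; apply/funext => x.
by have [_ E] := is_derive_coord j k x; exact: E.
Qed.

Lemma tameD (R : realType) n I (F G : I -> 'rV_n -> R) :
  @tame R n I F -> tame G -> tame (fun i x => F i x + G i x).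
Proof. by move=> TF TG N; exact: tameND. Qed.

Lemma tameM (R : realType) n I (F G : I -> 'rV_n -> R) :
  @tame R n I F -> tame G -> tame (fun i x => F i x * G i x).
Proof. by move=> TF TG N; exact: tameNM. Qed.

Lemma tameN1 (R : realType) n I (F : I -> 'rV_n -> R) :
  @tame R n I F -> tame (fun i x => - F i x).
Proof.
move=> TF; apply: (eq_tame _ (tameM (@tame_cst R n I (fun=> -1) 1 _) TF)) => [i x|i].
  by rewrite mulN1r.
by rewrite normrN1.
Qed.

Lemma tame_sum (R : realType) n I (J : Type) (r : seq J) (F : J -> I -> 'rV_n -> R) :
  (forall j, @tame R n I (F j)) -> tame (fun i x => \sum_(j <- r) F j i x).
Proof.
move=> TF; elim: r => [|j r IH].
  apply: (eq_tame _ (@tame_cst R n I (fun=> 0) 0 _)) => [i x|i].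
    by rewrite big_nil.
  by rewrite normr0.
by apply: (eq_tame _ (tameD (TF j) IH)) => i x; rewrite big_cons.
Qed.

(** Serves both to freeze one index and to enlarge the index by a step size. *)
Lemma tame_reindex (R : realType) n I J (h : J -> I) (F : I -> 'rV_n -> R) :
  @tame R n I F -> tame (fun j => F (h j)).
Proof.
move=> TF N; have := TF N; elim: N F {TF} => [|N IH] F [gF cF dF].
  by split => //; case: gF => C [m [C0 FC]]; exists C, m; split.
split; last split.
- by case: gF => C [m [C0 FC]]; exists C, m; split.
- by [].
- by move=> i; exact: dF.1.
- by move=> j; exact: IH (dF.2 j).
Qed.

Lemma tame_cst_fun (R : realType) n I (c : R) : @tame R n I (fun _ _ => c).
Proof. by apply: (@tame_cst _ _ _ _ `|c|). Qed.

Lemma tame_agg (R : realType) n I (gamma : 'I_n -> R) (x0 : R) :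
  @tame R n I (fun _ x => agg gamma x0 x).
Proof.
apply: tameD; first exact: tame_cst_fun.
by apply: tame_sum => j; apply: tameM; [exact: tame_cst_fun|exact: tame_coord].
Qed.

Lemma tame_L1 (R : realType) n I (rho : 'I_n -> R) (F : I -> 'rV_n -> R) :
  @tame R n I F -> tame (fun i => L1 rho (F i)).
Proof.
move=> TF; apply: tameN1; apply: tame_sum => j.
apply: tameM; last exact: tame_partial.
by apply: tameM; [exact: tame_cst_fun|exact: tame_coord].
Qed.

Lemma tame_L2 (R : realType) n I (gamma : 'I_n -> R) (x0 a k sigma : R) (F : I -> 'rV_n -> R) :
  @tame R n I F -> tame (fun i => L2 gamma x0 a k sigma (F i)).
Proof.
move=> TF; apply: tameD; apply: tameM.
- apply: tameD; first exact: tame_cst_fun.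
  by apply: tameN1; apply: tameM; [exact: tame_cst_fun|exact: tame_agg].
- by apply: tame_sum => j; exact: tame_partial.
- by apply: tameM; [exact: tame_cst_fun|exact: tame_agg].
- by apply: tame_sum => i; apply: tame_sum => j; do 2!apply: tame_partial.
Qed.

(** * The flow of the linear part *)

Lemma is_derive_ext (R : realType) (V W : normedModType R) (f g : V -> W) (x v : V) (l m : W) :
  is_derive x v f l -> (forall y, f y = g y) -> l = m -> is_derive x v g m.
Proof. by move=> H fg <-; rewrite (_ : g = f)//; apply/funext. Qed.

Lemma is_derive_of_line (R : realType) (V W : normedModType R) (f : V -> W) (x v : V) (l : W) :
  is_derive (0 : R) 1 (fun h => f (h *: v + x)) l -> is_derive x v f l.
Proof.
have E : (fun h : R => h^-1 *: (((fun h => f (h *: v + x)) \o shift 0) (h *: 1) - f (0 *: v + x))) =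
   (fun h => h^-1 *: ((f \o shift x) (h *: v) - f x)).
  by apply/funext => h /=; rewrite [h%:A]mulr1 addr0 scale0r add0r.
move=> [fd <-]; apply: DeriveDef.
  by move: fd; rewrite /derivable E.
by rewrite /derive E.
Qed.

(** The flow is diagonal: it sends a line in direction [j] to a line in the same direction, run at
    speed [e], so the one-dimensional chain rule suffices. *)
Lemma is_derive_psi1_dir (R : realType) n (rho : 'I_n -> R) (f : 'rV[R]_n -> R) (s : R) j x :
  (forall x, derivable f x (delta_mx 0 j)) ->
  is_derive x (delta_mx 0 j) (fun x => f (psi1 rho x s))
    (expR (- rho j * s) * partial j f (psi1 rho x s)).
Proof.
move=> fd; apply: is_derive_of_line.
set y := psi1 rho x s; set e := expR _.
have -> : (fun h : R => f (psi1 rho (h *: delta_mx 0 j + x) s)) =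
  (fun u => f (y + u *: delta_mx 0 j)) \o (fun h => e * h).
  apply/funext => h /=; congr f; apply/rowP => i; rewrite !mxE eqxx /= mulrDl addrC.
  congr (_ + _); case: eqP => [->|]; rewrite ?mulr0 ?mul0r //= !mulr1.
  by rewrite mulrC.
have d1 : is_derive (0 : R) 1 (fun h => e * h) e.
  have := is_deriveZ (f := @id R) e (is_derive_id (0 : R) 1).
  by rewrite [e%:A]mulr1.
have d2 := derivable_line (y := y) (s := e * 0) (fd (y + (e * 0) *: delta_mx 0 j)).
have := @is_derive1_comp _ _ _ _ _ _ d2 d1.
by rewrite mulr0 scale0r addr0 mulrC.
Qed.

Lemma psi1_0 (R : realType) n (rho : 'I_n -> R) x : psi1 rho x 0 = x.
Proof. by apply/rowP => i; rewrite mxE mulr0 expR0 mulr1. Qed.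

Lemma psi1_add (R : realType) n (rho : 'I_n -> R) x s t :
  psi1 rho (psi1 rho x s) t = psi1 rho x (s + t).
Proof. by apply/rowP => i; rewrite !mxE -mulrA -expRD mulrDr. Qed.

Lemma psi1_norm (R : realType) n (rho : 'I_n -> R) x s :
  (forall i, 0 <= rho i) -> 0 <= s -> `|psi1 rho x s| <= `|x|.
Proof.
move=> r0 s0; apply: rV_norm_le => // i; rewrite mxE normrM.
apply: le_trans (coord_le_norm x i); rewrite ler_piMr// ger0_norm ?expR_ge0//.
by rewrite -[leRHS]expR0 ler_expR mulNr oppr_le0 mulr_ge0.
Qed.

Lemma psi1_continuous (R : realType) n (rho : 'I_n -> R) s :
  (forall i, 0 <= rho i) -> 0 <= s -> continuous (fun x => psi1 rho x s).
Proof.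
move=> r0 s0 x.
apply: (@cvg_dist_le _ _ _ (nbhs_filter x) _ _ id _ x); last exact: cvg_id.
move=> y; have -> : psi1 rho y s - psi1 rho x s = psi1 rho (y - x) s.
  by apply/rowP => i; rewrite !mxE mulrBl.
exact: psi1_norm.
Qed.

(** The times [s i] may be unbounded over the family: the flow does not increase the norm, and each
    differentiation only brings out a factor [exp(- rho_j s)] in [[0, 1]]. *)
Lemma tame_psi1 (R : realType) n I (rho : 'I_n -> R) (F : I -> 'rV_n -> R) (s : I -> R) :
  (forall i, 0 <= rho i) -> (forall i, 0 <= s i) ->
  @tame R n I F -> tame (fun i x => F i (psi1 rho x (s i))).
Proof.
move=> r0 s0 TF N.
have g (G : I -> 'rV_n -> R) : tame G -> growth (fun i x => G i (psi1 rho x (s i))).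
  move=> TG; have [C [m [C0 GC]]] := tame_growth TG; exists C, m; split => // i x.
  apply: le_trans (GC _ _) _; rewrite ler_wpM2l// lerXn2r ?nnegrE ?addr_ge0//.
  by rewrite lerD2l psi1_norm.
have c (G : I -> 'rV_n -> R) i : tame G -> continuous (fun x => G i (psi1 rho x (s i))).
  move=> TG x; apply: (cvg_comp _ _ (@psi1_continuous _ _ _ _ r0 (s0 i) x)).
  exact: tame_continuous TG _.
elim: N F TF => [|N IH] F TF; first by split => [|i|] //; [exact: g|exact: c].
have d i j x : is_derive x (delta_mx 0 j) (fun x => F i (psi1 rho x (s i)))
    (expR (- rho j * s i) * partial j (F i) (psi1 rho x (s i))).
  by apply: is_derive_psi1_dir => y; exact: tame_derivable TF.
split; [exact: g|by move=> i; exact: c|split => [i j x|j]].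
  exact: @ex_derive _ _ _ _ _ _ _ (d i j x).
have -> : (fun i => partial j (fun x => F i (psi1 rho x (s i)))) =
  (fun i x => expR (- rho j * s i) * partial j (F i) (psi1 rho x (s i))).
  apply/funext => i; apply/funext => x; have [_ E] := d i j x; exact: E.
apply: tameNM; last exact: IH (tame_partial j TF).
apply: (@tame_cst _ _ _ _ 1) => i.
rewrite ger0_norm ?expR_ge0// -[leRHS]expR0 ler_expR mulNr oppr_le0 mulr_ge0//.
Qed.

Lemma is_derive_psi1_time (R : realType) n (rho : 'I_n -> R) (f : 'rV[R]_n -> R) x (r : R) :
  (forall i x, derivable f x (delta_mx 0 i)) ->
  (forall i, continuous (partial i f)) ->
  is_derive r 1 (fun r => f (psi1 rho x r)) (L1 rho f (psi1 rho x r)).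
Proof.
move=> fd fc.
have d := @is_derive_curve R n f (psi1 rho x) (\row_j (- rho j * psi1 rho x r 0 j)) r fd fc.
have -> : L1 rho f (psi1 rho x r) = \sum_(i < n) (\row_j (- rho j * psi1 rho x r 0 j)) 0 i * partial i f (psi1 rho x r).
  by rewrite /L1 -sumrN; apply: eq_bigr => i _; rewrite [in RHS]mxE !mulNr.
apply: d => i; rewrite mxE.
have -> : (fun s => psi1 rho x s 0 i) = (fun s => x 0 i * expR (- rho i * s)).
  by apply/funext => s; rewrite mxE.
have d1 : is_derive r 1 (fun h : R => - rho i * h) (- rho i).
  have := is_deriveZ (f := @id R) (- rho i) (is_derive_id (r : R) 1).
  by rewrite [(_)%:A]mulr1.
have d2 := @is_derive1_comp _ (@expR R) _ _ _ _ (is_derive_expR _) d1.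
have := is_deriveZ (x 0 i) d2.
rewrite mxE; congr is_derive.
rewrite /GRing.scale /=; ring.
Qed.

(** * Taylor expansion of the flow and its remainders *)

Lemma tame_iter_L1 (R : realType) n I (rho : 'I_n -> R) (F : I -> 'rV_n -> R) j :
  @tame R n I F -> tame (fun i => iter j (L1 rho) (F i)).
Proof. by move=> TF; elim: j => [|j IH] //=; exact: tame_L1. Qed.

(** Along the flow, the successive time derivatives of [f] are the iterates of [L1] on [f], so this
    is the one-dimensional Taylor formula in time. It controls the size of the remainder only;
    derivatives of the remainder in space are treated separately. *)
Lemma psi1_taylor (R : realType) n I (rho : 'I_n -> R) (F : I -> 'rV_n -> R) (s : I -> R) m :
  (forall i, 0 <= rho i) -> (forall i, 0 < s i) -> @tame R n I F ->
  growth (fun i x => (F i (psi1 rho x (s i)) -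
    \sum_(j < m) iter j (L1 rho) (F i) x * (s i ^+ j / j`!%:R)) / s i ^+ m).
Proof.
move=> r0 s0 TF.
have [C [p [C0 FC]]] := tame_growth (tame_iter_L1 rho m TF).
exists C, p; split => // i x.
have sm : 0 < s i ^+ m by rewrite exprn_gt0.
rewrite normrM normfV (gtr0_norm sm) ler_pdivrMr//.
pose g j r := iter j (L1 rho) (F i) (psi1 rho x r).
have := @taylor_bound R m g 0 (s i) (C * (1 + `|x|) ^+ p).
rewrite add0r (gtr0_norm (s0 i)).
under eq_bigr do rewrite {1}/g psi1_0.
move=> T; apply: T.
  move=> j r; apply: (@is_derive_psi1_time _ _ rho (iter j (L1 rho) (F i))).
    by move=> k y; exact: (@tame_derivable _ _ _ _ i k y (tame_iter_L1 rho j TF)).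
  by move=> k; exact: (@tame_continuous _ _ _ _ i (tame_partial k (tame_iter_L1 rho j TF))).
move=> u /andP[u0 u1]; apply: le_trans (FC _ _) _.
rewrite ler_wpM2l// lerXn2r ?nnegrE ?addr_ge0//.
by rewrite lerD2l psi1_norm// add0r mulr_ge0// ltW.
Qed.

(** The first two remainders get acted on by [L1] and [L2] in the splitting, so they have to be
    tame; the third is only ever evaluated, and growth is enough for it. *)
Definition psi1_rem1 (R : realType) n (rho : 'I_n -> R) (s : R) (f : 'rV[R]_n -> R) :=
  fun x => (f (psi1 rho x s) - f x) / s.

Definition psi1_rem2 (R : realType) n (rho : 'I_n -> R) (s : R) (f : 'rV[R]_n -> R) :=
  fun x => (f (psi1 rho x s) - f x - s * L1 rho f x) / s ^+ 2.

Definition psi1_rem3 (R : realType) n (rho : 'I_n -> R) (s : R) (f : 'rV[R]_n -> R) :=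
  fun x => (f (psi1 rho x s) - f x - s * L1 rho f x
            - s ^+ 2 / 2 * L1 rho (L1 rho f) x) / s ^+ 3.

Lemma psi1_rem1_growth (R : realType) n I (rho : 'I_n -> R) (F : I -> 'rV_n -> R) (s : I -> R) :
  (forall i, 0 <= rho i) -> (forall i, 0 < s i) -> @tame R n I F ->
  growth (fun i => psi1_rem1 rho (s i) (F i)).
Proof.
move=> r0 s0 TF; have [C [p [C0 H]]] := psi1_taylor 1 r0 s0 TF.
exists C, p; split => // i x; have := H i x.
by rewrite big_ord1 expr0 fact0 divr1 mulr1 expr1.
Qed.

Lemma psi1_rem2_growth (R : realType) n I (rho : 'I_n -> R) (F : I -> 'rV_n -> R) (s : I -> R) :
  (forall i, 0 <= rho i) -> (forall i, 0 < s i) -> @tame R n I F ->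
  growth (fun i => psi1_rem2 rho (s i) (F i)).
Proof.
move=> r0 s0 TF; have [C [p [C0 H]]] := psi1_taylor 2 r0 s0 TF.
exists C, p; split => // i x; have := H i x.
rewrite big_ord_recl big_ord1 expr0 fact0 divr1 mulr1 /= divr1 expr1 opprD addrA.
by rewrite (mulrC _ (s i)).
Qed.

Lemma psi1_rem3_growth (R : realType) n I (rho : 'I_n -> R) (F : I -> 'rV_n -> R) (s : I -> R) :
  (forall i, 0 <= rho i) -> (forall i, 0 < s i) -> @tame R n I F ->
  growth (fun i => psi1_rem3 rho (s i) (F i)).
Proof.
move=> r0 s0 TF; have [C [p [C0 H]]] := psi1_taylor 3 r0 s0 TF.
exists C, p; split => // i x; have := H i x.
rewrite !big_ord_recl big_ord0 addr0 expr0 fact0 divr1 mulr1 /= divr1 expr1 !opprD !addrA.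
by rewrite (mulrC _ (s i)) (mulrC _ (s i ^+ 2 / 2)).
Qed.

Lemma expR_taylor (R : realType) m (y M : R) :
  (forall u, 0 <= u <= 1 -> expR (u * y) <= M) ->
  `|expR y - \sum_(j < m) y ^+ j / j`!%:R| <= M * `|y| ^+ m.
Proof.
move=> yM.
have := @taylor_bound R m (fun _ => @expR R) 0 y M (fun _ => @is_derive_expR R).
rewrite add0r; under eq_bigr do rewrite expR0 mul1r.
by apply=> u u01; rewrite add0r ger0_norm ?expR_ge0// yM.
Qed.

Lemma expR_le1_segment (R : realType) (y : R) : y <= 0 ->
  forall u, 0 <= u <= 1 -> expR (u * y) <= 1.
Proof.
by move=> y0 u /andP[u0 u1]; rewrite -[leRHS]expR0 ler_expR mulr_ge0_le0.
Qed.

Lemma tame_clairaut (R : realType) n I (F : I -> 'rV[R]_n -> R) i j k :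
  tame F -> partial j (partial k (F i)) = partial k (partial j (F i)).
Proof.
move=> TF; apply: clairaut.
- by move=> x; exact: tame_derivable TF.
- by move=> x; exact: tame_derivable TF.
- by move=> x; exact: (@tame_derivable _ _ _ _ i _ x (tame_partial k TF)).
- by move=> x; exact: (@tame_derivable _ _ _ _ i _ x (tame_partial j TF)).
- exact: (@tame_continuous _ _ _ _ i (tame_partial _ (tame_partial k TF))).
- exact: (@tame_continuous _ _ _ _ i (tame_partial _ (tame_partial j TF))).
Qed.

(** The extra term comes from differentiating the coefficient [x_j] of the drift. This commutator
    expresses the derivatives of [psi1_rem2] through remainders of derivatives. *)
Lemma partial_L1 (R : realType) n I (rho : 'I_n -> R) (F : I -> 'rV[R]_n -> R) i j x :
  tame F ->
  partial j (L1 rho (F i)) x = L1 rho (partial j (F i)) x - rho j * partial j (F i) x.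
Proof.
move=> TF.
have d l : is_derive x (delta_mx 0 j) (fun x : 'rV[R]_n => rho l * x 0 l * partial l (F i) x)
   (rho l * x 0 l * partial l (partial j (F i)) x + (j == l)%:R * (rho l * partial l (F i) x)).
  have dc := is_deriveZ (rho l) (is_derive_coord l j x).
  have dp := derivableP (@tame_derivable _ _ _ _ i j x (tame_partial l TF)).
  (* Symmetry of mixed derivatives puts the outer derivative next to [F i]. *)
  have E : 'D_(delta_mx 0 j) (partial l (F i)) x = partial l (partial j (F i)) x.
    by have := congr1 (fun f => f x) (tame_clairaut i j l TF).
  rewrite E in dp; have dm := is_deriveM dc dp.
  apply: (is_derive_ext dm) => [y|]; first by [].
  rewrite /GRing.scale /= -[rho l *: x 0 l]/(rho l * x 0 l); ring.
have [_ E] := is_deriveN (is_derive_sum d).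
have EL : L1 rho (F i) =
    - \sum_(l < n) (fun x : 'rV[R]_n => rho l * x 0 l * partial l (F i) x).
  by apply/funext => y; rewrite /L1 !fctE fct_sumE.
rewrite [LHS]/partial EL.
rewrite E /L1 big_split /= opprD; congr (_ - _).
rewrite (bigD1 j)//= eqxx mul1r big1 ?addr0// => l lj.
by rewrite eq_sym (negbTE lj) mul0r.
Qed.

Lemma is_derive_sub_psi1 (R : realType) n I (rho : 'I_n -> R) (F : I -> 'rV_n -> R) (s : R) i j x :
  @tame R n I F ->
  is_derive x (delta_mx 0 j) (fun x => F i (psi1 rho x s) - F i x)
    (expR (- rho j * s) * partial j (F i) (psi1 rho x s) - partial j (F i) x).
Proof.
move=> TF; have fd y := @tame_derivable _ _ _ _ i j y TF.
exact: is_deriveB (is_derive_psi1_dir rho s x fd) (derivableP (fd x)).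
Qed.

(** Differentiation sends the remainder of [F] to [exp(- rho_j s)] times the remainder of its
    partial derivative, plus that derivative with coefficient [(exp(- rho_j s) - 1) / s]. Both
    coefficients are bounded uniformly in [s > 0], so induction on the order closes. *)
Lemma tame_psi1_rem1 (R : realType) n I (rho : 'I_n -> R) (F : I -> 'rV_n -> R) (s : I -> R) :
  (forall i, 0 <= rho i) -> (forall i, 0 < s i) -> @tame R n I F ->
  tame (fun i => psi1_rem1 rho (s i) (F i)).
Proof.
move=> r0 s0 TF N.
(* Continuity concerns one index at a time; with the index frozen, the factor [1 / s i] is a
   constant. *)
have c (G : I -> 'rV_n -> R) i : tame G -> continuous (psi1_rem1 rho (s i) (G i)).
  move=> TG.
  have TP := tame_psi1 r0 (fun i => ltW (s0 i)) TG.
  have T := tameM (tameD (tame_reindex (fun _ : unit => i) TP)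
     (tameN1 (tame_reindex (fun _ : unit => i) TG))) (tame_cst_fun _ _ (s i)^-1).
  exact: (@tame_continuous _ _ _ _ tt T).
elim: N F TF => [|N IH] F TF.
  by split => [|i|] //; [exact: psi1_rem1_growth|exact: c].
have d i j x : is_derive x (delta_mx 0 j) (psi1_rem1 rho (s i) (F i))
   (expR (- rho j * s i) * psi1_rem1 rho (s i) (partial j (F i)) x +
    ((expR (- rho j * s i) - 1) / s i) * partial j (F i) x).
  have D := is_deriveZ (s i)^-1 (is_derive_sub_psi1 rho (s i) i j x TF).
  apply: (is_derive_ext D) => [y|].
    by rewrite /psi1_rem1 mulrC.
  have sn : s i != 0 by rewrite gt_eqF.
  by rewrite /psi1_rem1 /GRing.scale /=; field.
split; [exact: psi1_rem1_growth|by move=> i; exact: c|split => [i j x|j]].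
  exact: @ex_derive _ _ _ _ _ _ _ (d i j x).
have -> : (fun i => partial j (psi1_rem1 rho (s i) (F i))) = (fun i x =>
    expR (- rho j * s i) * psi1_rem1 rho (s i) (partial j (F i)) x +
    ((expR (- rho j * s i) - 1) / s i) * partial j (F i) x).
  apply/funext => i; apply/funext => x; have [_ E] := d i j x; exact: E.
have TJ := tame_partial j TF.
apply: tameND; apply: tameNM.
- apply: (@tame_cst _ _ _ _ 1) => i.
  rewrite ger0_norm ?expR_ge0// -[leRHS]expR0 ler_expR mulNr oppr_le0 mulr_ge0//.
  exact: ltW.
- exact: IH.
- apply: (@tame_cst _ _ _ _ (rho j)) => i.
  have y0 : - rho j * s i <= 0 by rewrite mulNr oppr_le0 mulr_ge0// ltW.
  have := expR_taylor 1 (expR_le1_segment y0).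
  rewrite big_ord1 expr0 fact0 divr1 expr1 mul1r normrM normrN => H.
  rewrite normrM normfV (gtr0_norm (s0 i)) ler_pdivrMr//.
  by rewrite (le_trans H)// (gtr0_norm (s0 i)) ger0_norm.
- exact: TJ.
Qed.

(** Same closed system as for the first remainder. The commutator adds [rho_j s] to
    [exp(- rho_j s) - 1], which makes this coefficient of order [s^2] and so compensates the
    division by [s^2]. *)
Lemma tame_psi1_rem2 (R : realType) n I (rho : 'I_n -> R) (F : I -> 'rV_n -> R) (s : I -> R) :
  (forall i, 0 <= rho i) -> (forall i, 0 < s i) -> @tame R n I F ->
  tame (fun i => psi1_rem2 rho (s i) (F i)).
Proof.
move=> r0 s0 TF N.
have c (G : I -> 'rV_n -> R) i : tame G -> continuous (psi1_rem2 rho (s i) (G i)).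
  move=> TG.
  have TP := tame_psi1 r0 (fun i => ltW (s0 i)) TG.
  pose h (_ : unit) := i.
  have T := tameM (tameD (tameD (tame_reindex h TP) (tameN1 (tame_reindex h TG)))
     (tameN1 (tameM (tame_cst_fun _ _ (s i)) (tame_reindex h (tame_L1 rho TG)))))
     (tame_cst_fun _ _ (s i ^+ 2)^-1).
  exact: (@tame_continuous _ _ _ _ tt T).
elim: N F TF => [|N IH] F TF.
  by split => [|i|] //; [exact: psi1_rem2_growth|exact: c].
have d i j x : is_derive x (delta_mx 0 j) (psi1_rem2 rho (s i) (F i))
   (expR (- rho j * s i) * psi1_rem2 rho (s i) (partial j (F i)) x +
    ((expR (- rho j * s i) - 1 + rho j * s i) / s i ^+ 2) * partial j (F i) x +
    ((expR (- rho j * s i) - 1) / s i) * L1 rho (partial j (F i)) x).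
  have dL := derivableP (@tame_derivable _ _ _ _ i j x (tame_L1 rho TF)).
  have dL' := is_deriveZ (s i) dL.
  have D := is_deriveZ (s i ^+ 2)^-1 (is_deriveB (is_derive_sub_psi1 rho (s i) i j x TF) dL').
  have E : 'D_(delta_mx 0 j) (L1 rho (F i)) x = L1 rho (partial j (F i)) x - rho j * partial j (F i) x.
    exact: partial_L1.
  rewrite E in D.
  have sn : s i != 0 by rewrite gt_eqF.
  apply: (is_derive_ext D) => [y|].
    by rewrite /psi1_rem2 mulrC.
  by rewrite /psi1_rem2 /GRing.scale /=; field.
split; [exact: psi1_rem2_growth|by move=> i; exact: c|split => [i j x|j]].
  exact: @ex_derive _ _ _ _ _ _ _ (d i j x).
have -> : (fun i => partial j (psi1_rem2 rho (s i) (F i))) = (fun i x =>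
   (expR (- rho j * s i) * psi1_rem2 rho (s i) (partial j (F i)) x +
    ((expR (- rho j * s i) - 1 + rho j * s i) / s i ^+ 2) * partial j (F i) x +
    ((expR (- rho j * s i) - 1) / s i) * L1 rho (partial j (F i)) x)).
  apply/funext => i; apply/funext => x; have [_ E] := d i j x; exact: E.
have TJ := tame_partial j TF.
have y0 i : - rho j * s i <= 0 by rewrite mulNr oppr_le0 mulr_ge0// ltW.
apply: tameND; first apply: tameND; apply: tameNM.
- apply: (@tame_cst _ _ _ _ 1) => i.
  rewrite ger0_norm ?expR_ge0// -[leRHS]expR0 ler_expR//.
- exact: IH.
- apply: (@tame_cst _ _ _ _ (rho j ^+ 2)) => i.
  have := expR_taylor 2 (expR_le1_segment (y0 i)).
  rewrite big_ord_recl big_ord1 expr0 fact0 divr1 expr1 /= divr1 mul1r => H.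
  rewrite normrM normfV (gtr0_norm (exprn_gt0 2 (s0 i))) ler_pdivrMr ?exprn_gt0//.
  rewrite !mulNr opprD opprK addrA in H.
  by rewrite !mulNr (le_trans H)// normrN normrM (gtr0_norm (s0 i)) ger0_norm// exprMn.
- exact: TJ.
- apply: (@tame_cst _ _ _ _ (rho j)) => i.
  have := expR_taylor 1 (expR_le1_segment (y0 i)).
  rewrite big_ord1 expr0 fact0 divr1 expr1 mul1r normrM normrN => H.
  rewrite normrM normfV (gtr0_norm (s0 i)) ler_pdivrMr//.
  by rewrite (le_trans H)// (gtr0_norm (s0 i)) ger0_norm.
- exact: tame_L1.
Qed.

(** * Test functions sharing a good sequence *)

Notation words f s := (foldr (@partial _ _) f s).

Lemma enorm_ge0 (R : realType) n (x : 'rV[R]_n) : 0 <= enorm x.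
Proof. exact: sqrtr_ge0. Qed.

Lemma norm_le_enorm (R : realType) n (x : 'rV[R]_n) : `|x| <= enorm x.
Proof.
apply: rV_norm_le => [|j]; first exact: enorm_ge0.
rewrite -sqrtr_sqr /enorm ler_wsqrtr// (bigD1 j)//= lerDl sumr_ge0// => i _.
exact: sqr_ge0.
Qed.

Lemma enorm_le_norm (R : realType) n (x : 'rV[R]_n) : enorm x <= n%:R * `|x|.
Proof.
have nx : 0 <= n%:R * `|x| by rewrite mulr_ge0.
rewrite -[leRHS](ger0_norm nx) -sqrtr_sqr ler_wsqrtr//.
apply: (@le_trans _ _ (\sum_(i < n) `|x| ^+ 2)).
  apply: ler_sum => i _; rewrite -real_normK ?num_real//.
  by rewrite lerXn2r ?nnegrE// coord_le_norm.
rewrite sumr_const card_ord -[leLHS]mulr_natl exprMn ler_wpM2r ?sqr_ge0//.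
by rewrite -natrX ler_nat; case: n {x nx} => // n; rewrite leq_pmulr.
Qed.

(** False for [m = 0]: this is where the positivity of the exponents of a good sequence enters. *)
Lemma add1_exp_le (R : realType) (a : R) m :
  0 <= a -> (0 < m)%N -> 1 + a ^+ m <= (1 + a) ^+ m.
Proof.
move=> a0; case: m => // m _; rewrite [leRHS]exprS mulrDl mul1r exprS; apply: lerD.
  by rewrite exprn_ege1// lerDl.
by rewrite ler_wpM2l// lerXn2r ?nnegrE ?addr_ge0// lerDr.
Qed.

Lemma add1_exp_enorm (R : realType) n (x : 'rV[R]_n) m : (0 < m)%N ->
  1 + enorm x ^+ m <= ((1 + n%:R) * (1 + `|x|)) ^+ m.
Proof.
move=> m0; apply: le_trans (add1_exp_le (enorm_ge0 x) m0) _.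
have xx := normr_ge0 x; have nn : 0 <= n%:R :> R by [].
rewrite lerXn2r ?nnegrE ?addr_ge0 ?mulr_ge0 ?addr_ge0 ?enorm_ge0//.
by have := enorm_le_norm x; lra.
Qed.

Lemma smooth_words (R : realType) n (f : 'rV[R]_n -> R) w i x :
  smooth f -> derivable (words f w) x (delta_mx 0 i).
Proof. by move=> /(_ w) [_ D]; exact: D. Qed.

Lemma smooth_continuous (R : realType) n (f : 'rV[R]_n -> R) w :
  smooth f -> continuous (words f w).
Proof. by move=> /(_ w) []. Qed.

Lemma words_swap (R : realType) n (f : 'rV[R]_n -> R) i j w : smooth f ->
  partial i (partial j (words f w)) = partial j (partial i (words f w)).
Proof.
move=> sf; apply: clairaut.
- by move=> x; exact: smooth_words.
- by move=> x; exact: smooth_words.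
- by move=> x; exact: (@smooth_words _ _ _ (j :: w)).
- by move=> x; exact: (@smooth_words _ _ _ (i :: w)).
- exact: (@smooth_continuous _ _ _ (i :: j :: w)).
- exact: (@smooth_continuous _ _ _ (j :: i :: w)).
Qed.

(** A good sequence bounds derivatives taken in one canonical order, while tameness asks for all
    orders. The fact [mv] moves a letter through a prefix by adjacent swaps, which generate all
    permutations. *)
Lemma words_perm (R : realType) n (f : 'rV[R]_n -> R) w w' : smooth f ->
  perm_eq w w' -> words f w = words f w'.
Proof.
move=> sf.
have mv i s1 s2 : words f (i :: s1 ++ s2) = words f (s1 ++ i :: s2).
  elim: s1 => [|j s1 IH] //=; rewrite -IH /=; exact: words_swap.
elim: w w' => [|i w IH] w'.
  by move=> /perm_size /= /esym/size0nil ->.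
move=> p; have : i \in w' by rewrite -(perm_mem p) mem_head.
move=> iw'; case/splitPr: iw' p => s1 s2 p.
rewrite -mv /= (IH (s1 ++ s2))//.
by move: p; rewrite perm_sym -cat1s perm_catCA /= perm_cons perm_sym.
Qed.

Lemma mpartial_words (R : realType) n (f : 'rV[R]_n -> R) w : smooth f ->
  words f w = mpartial [ffun i => count_mem i w] f.
Proof.
move=> sf.
set alpha := [ffun i => _].
(* A multi-index derivative is the word in which each coordinate is repeated as often as [alpha]
   prescribes. *)
have E s : foldr (fun i g => iter (alpha i) (partial i) g) f s =
    words f (flatten [seq nseq (alpha i) i | i <- s]).
  elim: s => [|i s IH] //=; rewrite foldr_cat IH.
  by elim: (alpha i) => [|m IHm] //=; rewrite IHm.
rewrite /mpartial E; apply: words_perm => //.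
apply/allP => i _ /=.
rewrite count_flatten -map_comp sumnE big_map big_enum /= (bigD1 i)//= big1.
  by rewrite addn0 count_nseq /= eqxx mul1n ffunE.
by move=> j ji; rewrite count_nseq /= (negbTE ji).
Qed.

(** An index type whose elements are the test functions themselves; the family is then the
    projection [sval]. *)
Definition good_class (R : realType) n (Cf : {ffun 'I_n -> nat} -> R)
    (ef : {ffun 'I_n -> nat} -> nat) :=
  {f : 'rV[R]_n -> R | Cinfpol f /\ good_sequence Cf ef f}.

Lemma tame_good_class (R : realType) n (Cf : {ffun 'I_n -> nat} -> R)
    (ef : {ffun 'I_n -> nat} -> nat) :
  tame (fun f : good_class Cf ef => sval f).
Proof.
have H N w : tameN N (fun f : good_class Cf ef => words (sval f) w).
  elim: N w => [|N IH] w; (split; last split) => //.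
  (* The class may be empty, and then nothing says that [Cf al] is positive; the maximum with 0
     gives a valid constant in every case. *)
  1,3 : pose al := [ffun i => count_mem i w];
    exists (Num.max 0 (Cf al) * (1 + n%:R) ^+ ef al), (ef al); split;
    first (by rewrite mulr_ge0 ?exprn_ge0 ?addr_ge0// le_max lexx);
    move=> [f [[sf _] gf]] x /=; rewrite mpartial_words// -/al;
    have [C0 e0 fC] := gf al; apply: le_trans (fC x) _;
    rewrite (max_r (ltW C0)) -mulrA ler_wpM2l ?(ltW C0)// -exprMn.
  1,2: exact: add1_exp_enorm.
  - by move=> [f [[sf ?] gf]] /=; exact: smooth_continuous.
  - by move=> [f [[sf ?] gf]] /=; exact: smooth_continuous.
  - by move=> [f [[sf ?] gf]] j x /=; exact: smooth_words.
  - by move=> j; exact: (IH (j :: w)).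
move=> N; exact: (H N [::]).
Qed.

(** * Second-order expansions in the time step *)

Definition pb (R : realType) (Q : R -> R -> R) :=
  exists C m, 0 <= C /\
    forall t x, 0 < t -> t <= 1 -> 0 <= x -> `|Q t x| <= C * (1 + x) ^+ m.

Lemma pbD (R : realType) (F G : R -> R -> R) :
  pb F -> pb G -> pb (fun t x => F t x + G t x).
Proof.
move=> [C [m [C0 FC]]] [D [p [D0 GD]]]; exists (C + D), (m + p)%N; split.
  exact: addr_ge0.
move=> t x t0 t1 xx; apply: le_trans (ler_normD _ _) _.
have w1 : 1 <= 1 + x by rewrite lerDl.
rewrite mulrDl; apply: lerD.
  by apply: le_trans (FC t x t0 t1 xx) _; rewrite ler_wpM2l// ler_weXn2l// leq_addr.
by apply: le_trans (GD t x t0 t1 xx) _; rewrite ler_wpM2l// ler_weXn2l// leq_addl.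
Qed.

Lemma pbM (R : realType) (F G : R -> R -> R) :
  pb F -> pb G -> pb (fun t x => F t x * G t x).
Proof.
move=> [C [m [C0 FC]]] [D [p [D0 GD]]]; exists (C * D), (m + p)%N; split.
  exact: mulr_ge0.
by move=> t x t0 t1 xx; rewrite normrM exprD mulrACA ler_pM ?FC ?GD.
Qed.

Lemma pb_cst (R : realType) (c : R) : pb (fun _ _ => c).
Proof. by exists `|c|, 0%N; split => // t x _ _ _; rewrite expr0 mulr1. Qed.

Lemma pb_t (R : realType) : pb (fun t _ : R => t).
Proof.
exists 1, 0%N; split => // t x t0 t1 _; rewrite expr0 mulr1.
by rewrite gtr0_norm.
Qed.

Lemma pb_x (R : realType) : pb (fun _ x : R => x).
Proof.
exists 1, 1%N; split => // t x _ _ x0; rewrite expr1 mul1r.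
by rewrite ger0_norm// lerDr.
Qed.

Lemma pbN (R : realType) (F : R -> R -> R) : pb F -> pb (fun t x => - F t x).
Proof.
by move=> [C [m [C0 FC]]]; exists C, m; split => // t x t0 t1 x0; rewrite normrN FC.
Qed.

Lemma pbX (R : realType) (F : R -> R -> R) m : pb F -> pb (fun t x => F t x ^+ m).
Proof.
move=> pF; elim: m => [|m IH]; first exact: pb_cst.
by under eq_fun do under eq_fun do rewrite exprS; exact: pbM.
Qed.

Lemma pb_abs (R : realType) (F : R -> R -> R) : pb F -> pb (fun t x => `|F t x|).
Proof.
by move=> [C [m [C0 FC]]]; exists C, m; split => // t x t0 t1 x0; rewrite normr_id FC.
Qed.

Lemma pb_bounded (R : realType) (c : R -> R) (K : R) :
  (forall t, 0 < t -> t <= 1 -> `|c t| <= K) -> pb (fun t _ => c t).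
Proof.
move=> cK; exists `|K|, 0%N; split => // t x t0 t1 _; rewrite expr0 mulr1.
by apply: le_trans (ler_norm _); exact: cK.
Qed.

(* [F t x = p x + q x t + r x t^2 + O(t^3)], with polynomial growth in [x]. *)
Definition ex2 (R : realType) (F : R -> R -> R) (p q r : R -> R) :=
  [/\ pb (fun _ => p), pb (fun _ => q), pb (fun _ => r) & exists Q, pb Q /\
   forall t x, 0 < t -> t <= 1 -> 0 <= x ->
     F t x = p x + q x * t + r x * t ^+ 2 + t ^+ 3 * Q t x].

Ltac pb_tac := repeat first [assumption | apply: pb_cst | apply: pb_t | apply: pb_x
  | apply: pbD | apply: pbN | apply: pbM | apply: pbX].

Lemma ex2_eq (R : realType) (F : R -> R -> R) (p q r p' q' r' : R -> R) :
  ex2 F p q r -> (forall x, p x = p' x) -> (forall x, q x = q' x) ->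
  (forall x, r x = r' x) -> ex2 F p' q' r'.
Proof. by move=> H /funext <- /funext <- /funext <-. Qed.

Lemma ex2_ext (R : realType) (F G : R -> R -> R) p q r :
  ex2 F p q r -> (forall t x, F t x = G t x) -> ex2 G p q r.
Proof.
move=> H FG; rewrite (_ : G = F)//.
by apply/funext => t; apply/funext => x; rewrite FG.
Qed.

Lemma ex2D (R : realType) (F G : R -> R -> R) p q r p' q' r' :
  ex2 F p q r -> ex2 G p' q' r' ->
  ex2 (fun t x => F t x + G t x) (fun x => p x + p' x) (fun x => q x + q' x)
    (fun x => r x + r' x).
Proof.
move=> [pp pq pr [Q [pQ FQ]]] [pp' pq' pr' [Q' [pQ' GQ]]]; split; [exact: pbD..|].
exists (fun t x => Q t x + Q' t x); split; first exact: pbD.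
by move=> t x t0 t1 x0; rewrite FQ// GQ//; ring.
Qed.

Lemma ex2M (R : realType) (F G : R -> R -> R) p q r p' q' r' :
  ex2 F p q r -> ex2 G p' q' r' ->
  ex2 (fun t x => F t x * G t x) (fun x => p x * p' x)
    (fun x => p x * q' x + q x * p' x)
    (fun x => p x * r' x + q x * q' x + r x * p' x).
Proof.
move=> [pp pq pr [Q [pQ FQ]]] [pp' pq' pr' [Q' [pQ' GQ]]].
split; [by pb_tac..|].
(* The terms of degree at least three of the product, divided by [t^3]. *)
exists (fun t x => p x * Q' t x + Q t x * p' x + (q x * r' x + r x * q' x)
  + t * (r x * r' x + (q x * Q' t x + Q t x * q' x))
  + t ^+ 2 * (r x * Q' t x + Q t x * r' x) + t ^+ 3 * (Q t x * Q' t x)).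
split; first by pb_tac.
by move=> t x t0 t1 x0; rewrite FQ// GQ//; ring.
Qed.

Lemma ex2_cst (R : realType) (c : R) :
  ex2 (fun _ _ => c) (fun=> c) (fun=> 0) (fun=> 0).
Proof.
split; [exact: pb_cst..|]; exists (fun _ _ => 0); split; first exact: pb_cst.
by move=> t x _ _ _; ring.
Qed.

Lemma ex2_x (R : realType) : ex2 (fun _ x : R => x) id (fun=> 0) (fun=> 0).
Proof.
split; [exact: pb_x|exact: pb_cst..|]; exists (fun _ _ => 0); split; first exact: pb_cst.
by move=> t x _ _ _; ring.
Qed.

Lemma ex2_t (R : realType) : ex2 (fun t _ : R => t) (fun=> 0) (fun=> 1) (fun=> 0).
Proof.
split; [exact: pb_cst..|]; exists (fun _ _ => 0); split; first exact: pb_cst.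
by move=> t x _ _ _; ring.
Qed.

Lemma ex2N (R : realType) (F : R -> R -> R) p q r :
  ex2 F p q r -> ex2 (fun t x => - F t x) (fun x => - p x) (fun x => - q x) (fun x => - r x).
Proof.
move=> [pp pq pr [Q [pQ FQ]]]; split; [exact: pbN..|].
exists (fun t x => - Q t x); split; first exact: pbN.
by move=> t x t0 t1 x0; rewrite FQ//; ring.
Qed.

Lemma ex2_pb (R : realType) (F : R -> R -> R) p q r : ex2 F p q r ->
  exists C m, 0 <= C /\ forall t x, 0 < t -> t <= 1 -> 0 <= x -> `|F t x| <= C * (1 + x) ^+ m.
Proof.
move=> [pp pq pr [Q [pQ FQ]]].
have [C [m [C0 H]]] :
    pb (fun t x => p x + q x * t + r x * t ^+ 2 + t ^+ 3 * Q t x) by pb_tac.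
by exists C, m; split => // t x t0 t1 x0; rewrite FQ// H.
Qed.

Lemma ex2_remainder (R : realType) (F : R -> R -> R) p q r : ex2 F p q r ->
  exists C m, 0 <= C /\ forall t x, 0 < t -> t <= 1 -> 0 <= x ->
    `|F t x - (p x + q x * t + r x * t ^+ 2)| <= C * t ^+ 3 * (1 + x) ^+ m.
Proof.
move=> [_ _ _ [Q [[C [m [C0 QC]]] FQ]]]; exists C, m; split => // t x t0 t1 x0.
rewrite FQ// addrAC subrr add0r normrM gtr0_norm ?exprn_gt0//.
by rewrite [leRHS]mulrAC [leRHS]mulrC ler_wpM2l ?QC// ltW// exprn_gt0.
Qed.

Lemma expR_le_norm (R : realType) (y : R) : forall u, 0 <= u <= 1 -> expR (u * y) <= expR `|y|.
Proof.
move=> u /andP[u0 u1]; rewrite ler_expR (le_trans (ler_norm _))// normrM ger0_norm//.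
by rewrite ler_piMl.
Qed.

Lemma ex2_expR (R : realType) (k : R) :
  ex2 (fun t _ => expR (k * t)) (fun=> 1) (fun=> k) (fun=> k ^+ 2 / 2).
Proof.
split; [exact: pb_cst..|].
exists (fun t _ => (expR (k * t) - (1 + k * t + (k * t) ^+ 2 / 2)) / t ^+ 3).
split; last first.
  move=> t x t0 _ _; have tn : t != 0 by rewrite gt_eqF.
  by field.
apply: (@pb_bounded _ _ (expR `|k| * `|k| ^+ 3)) => t t0 t1.
have := expR_taylor 3 (@expR_le_norm _ (k * t)).
rewrite !big_ord_recl big_ord0 addr0 expr0 fact0 divr1 /= divr1 expr1 addrA => H.
rewrite normrM normfV (gtr0_norm (exprn_gt0 3 t0)) ler_pdivrMr ?exprn_gt0//.
apply: le_trans H _; rewrite !normrM (gtr0_norm t0) exprMn mulrA ler_wpM2r ?exprn_ge0 ?(ltW t0)//.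
by rewrite ler_wpM2r ?exprn_ge0// ler_expR ler_piMr.
Qed.

Lemma ex2_zeta (R : realType) (k c : R) : 0 < c -> c <= 1 ->
  ex2 (fun t _ => zeta k (c * t)) (fun=> 0) (fun=> c) (fun=> - (k * c ^+ 2 / 2)).
Proof.
move=> c0 c1; rewrite /zeta; case: eqP => [->|/eqP k0].
  by apply: (ex2_eq (ex2M (ex2_cst c) (ex2_t R))) => x; ring.
have e3 : ex2 (fun t _ => k^-1 * (1 + - expR ((- k * c) * t))) (fun=> 0) (fun=> c) (fun=> - (k * c ^+ 2 / 2)).
  apply: (ex2_eq (ex2M (ex2_cst k^-1) (ex2D (ex2_cst 1) (ex2N (ex2_expR (- k * c)))))) => x.
  - by field.
  - by field.
  - by field.
by apply: (ex2_ext e3) => t x; rewrite mulrC mulrA.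
Qed.

(* With [w] the three-valued weight, the scheme above its threshold reaches
   [x + nv_delta] if [w = 0] and [x + nv_delta + nv_shift +- sqrt nv_var]
   otherwise: only the square of the last term enters the moments, and it is
   smooth in [t]. *)
Definition nv_delta (R : realType) (a k s t x : R) : R :=
  let e := expR (- (k * t) / 2) in let c := a - s ^+ 2 / 4 in
  e * (c * zeta k (t / 2) + e * x) + c * zeta k (t / 2) - x.

Definition nv_shift (R : realType) (k s t : R) : R :=
  expR (- (k * t) / 2) * (3 / 4 * s ^+ 2 * t).

Definition nv_var (R : realType) (a k s t x : R) : R :=
  let e := expR (- (k * t) / 2) in let c := a - s ^+ 2 / 4 in
  3 * s ^+ 2 * t * (e * e * (c * zeta k (t / 2) + e * x)).

Lemma ex2_exp_half (R : realType) (k : R) :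
  ex2 (fun t _ => expR (- (k * t) / 2)) (fun=> 1) (fun=> - (k / 2)) (fun=> k ^+ 2 / 8).
Proof.
have e := ex2_expR (- (k / 2)).
apply: (ex2_eq (ex2_ext e _)) => [t x|x|x|x]; [|by []|by []|by field].
by congr expR; field.
Qed.

Lemma ex2_zeta_half (R : realType) (k : R) :
  ex2 (fun t _ => zeta k (t / 2)) (fun=> 0) (fun=> 1 / 2) (fun=> - (k / 8)).
Proof.
have h0 : 0 < 1 / 2 :> R by lra.
have h1 : 1 / 2 <= 1 :> R by lra.
apply: (ex2_eq (ex2_ext (ex2_zeta k h0 h1) _)) => [t x|x|x|x]; [|by []|by []|by field].
by congr zeta; field.
Qed.

Lemma ex2_zeta1 (R : realType) (k : R) :
  ex2 (fun t _ => zeta k t) (fun=> 0) (fun=> 1) (fun=> - (k / 2)).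
Proof.
apply: (ex2_eq (ex2_ext (ex2_zeta k (@ltr01 R) (lexx 1)) _)) => [t x|x|x|x].
- by rewrite mul1r.
- by [].
- by [].
- by field.
Qed.

Lemma ex2_nv_delta (R : realType) (a k s : R) :
  ex2 (fun t x => nv_delta a k s t x) (fun=> 0) (fun x => a - s ^+ 2 / 4 - k * x)
    (fun x => k ^+ 2 * x / 2 - (a - s ^+ 2 / 4) * k / 2).
Proof.
pose e := ex2_exp_half k; pose cz := ex2M (ex2_cst (a - s ^+ 2 / 4)) (ex2_zeta_half k).
apply: (ex2_eq (ex2D (ex2D (ex2M e (ex2D cz (ex2M e (ex2_x R)))) cz) (ex2N (ex2_x R)))) => x.
- by ring.
- by field.
- by field.
Qed.

Lemma ex2_nv_shift (R : realType) (k s : R) :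
  ex2 (fun t x => nv_shift k s t) (fun=> 0) (fun x => 3 / 4 * s ^+ 2)
    (fun x => - (3 / 8 * s ^+ 2 * k)).
Proof.
apply: (ex2_eq (ex2M (ex2_exp_half k) (ex2M (ex2_cst (3 / 4 * s ^+ 2)) (ex2_t R)))) => x.
- by ring.
- by field.
- by field.
Qed.

Lemma ex2_nv_var (R : realType) (a k s : R) :
  ex2 (fun t x => nv_var a k s t x) (fun=> 0) (fun x => 3 * s ^+ 2 * x)
    (fun x => 3 * s ^+ 2 * ((a - s ^+ 2 / 4) / 2 - 3 / 2 * k * x)).
Proof.
pose e := ex2_exp_half k; pose cz := ex2M (ex2_cst (a - s ^+ 2 / 4)) (ex2_zeta_half k).
apply: (ex2_eq (ex2M (ex2M (ex2_cst (3 * s ^+ 2)) (ex2_t R))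
  (ex2M (ex2M e e) (ex2D cz (ex2M e (ex2_x R)))))) => x.
- by ring.
- by field.
- by field.
Qed.

(* The coefficients of [t] and [t^2] in the moment of order [j] of [Y_t - x], that
   is [L h x] and [L (L h) x / 2] for [h y = (y - x)^j], where
   [L h y = (a - k y) h' y + s^2 / 2 y h'' y]. *)
Definition mom1 (R : realType) (a k s : R) (j : nat) (x : R) : R :=
  match j with 1 => a - k * x | 2 => s ^+ 2 * x | _ => 0 end.

Definition mom2 (R : realType) (a k s : R) (j : nat) (x : R) : R :=
  match j with
  | 1 => - (k * (a - k * x) / 2)
  | 2 => (a - k * x) ^+ 2 + s ^+ 2 / 2 * (a - k * x) - k * s ^+ 2 * x
  | 3 => 3 * ((a - k * x) * s ^+ 2 * x + s ^+ 4 / 2 * x)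
  | 4 => 3 * s ^+ 4 * x ^+ 2
  | _ => 0 end.

(** Weight 2/3 for the middle value, 1/6 for each of the other two. Averaging [(v + sqrt w)^j] and
    [(v - sqrt w)^j] keeps the even powers of [sqrt w], with their binomial coefficients; the last
    branch is meant for [j = 6]. *)
Definition nv_mom (R : realType) (a k s : R) (j : nat) (t x : R) : R :=
  let u := nv_delta a k s t x in let v := u + nv_shift k s t in
  let w := nv_var a k s t x in
  2 / 3 * u ^+ j + 1 / 3 *
  match j with
  | 1 => v
  | 2 => v ^+ 2 + w
  | 3 => v ^+ 3 + 3 * (v * w)
  | 4 => v ^+ 4 + 6 * (v ^+ 2 * w) + w ^+ 2
  | 5 => v ^+ 5 + 10 * (v ^+ 3 * w) + 5 * (v * w ^+ 2)
  | _ => v ^+ 6 + 15 * (v ^+ 4 * w) + 15 * (v ^+ 2 * w ^+ 2) + w ^+ 3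
  end.

Lemma ex2X2 (R : realType) (F : R -> R -> R) q r :
  ex2 F (fun=> 0) q r ->
  ex2 (fun t x => F t x ^+ 2) (fun=> 0) (fun=> 0) (fun x => q x ^+ 2).
Proof.
move=> F2; apply: (ex2_ext _ (F := fun t x => F t x * F t x)) => [|t x]; last by rewrite expr2.
by apply: (ex2_eq (ex2M F2 F2)) => x; ring.
Qed.

Lemma ex2X3 (R : realType) (F : R -> R -> R) q r j :
  ex2 F (fun=> 0) q r ->
  ex2 (fun t x => F t x ^+ j.+3) (fun=> 0) (fun=> 0) (fun x => 0).
Proof.
move=> F2; elim: j => [|j IH].
  apply: (ex2_ext _ (F := fun t x => F t x ^+ 2 * F t x)) => [|t x]; last by rewrite -exprSr.
  by apply: (ex2_eq (ex2M (ex2X2 F2) F2)) => x; ring.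
apply: (ex2_ext _ (F := fun t x => F t x ^+ j.+3 * F t x)) => [|t x]; last by rewrite -exprSr.
by apply: (ex2_eq (ex2M IH F2)) => x; ring.
Qed.

(** The quantities [u], [v] and [w] vanish at [t = 0], so only products of at most two of them
    contribute up to [t^2]. The closing [field] goals are the moment-matching identities of the
    scheme. *)
Lemma ex2_nv_mom (R : realType) (a k s : R) j : (0 < j)%N -> (j <= 6)%N ->
  ex2 (nv_mom a k s j) (fun=> 0) (mom1 a k s j) (mom2 a k s j).
Proof.
pose u2 := ex2_nv_delta a k s; pose v2 := ex2D u2 (ex2_nv_shift k s).
pose w2 := ex2_nv_var a k s.
(* Normalises the leading coefficient [0 + 0] to [0], the form that [ex2X2] and [ex2X3] expect. *)
have v2' := ex2_eq v2 (fun x => addr0 0) (fun=> erefl) (fun=> erefl).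
have c := ex2_cst (2 / 3 : R); have d := ex2_cst (1 / 3 : R).
case: j => [//|[|[|[|[|[|[|//]]]]]]] _ _.
- apply: (ex2_eq (ex2_ext (ex2D (ex2M c u2) (ex2M d v2')) _)) => [t x|x|x|x] /=.
  + by rewrite /nv_mom expr1.
  + by field.
  + by field.
  + by field.
- apply: (ex2_eq (ex2_ext (ex2D (ex2M c (ex2X2 u2)) (ex2M d (ex2D (ex2X2 v2') w2))) _))
    => [t x|x|x|x] //=.
  + by field.
  + by field.
  + by field.
- apply: (ex2_eq (ex2_ext (ex2D (ex2M c (ex2X3 0 u2)) (ex2M d (ex2D (ex2X3 0 v2')
     (ex2M (ex2_cst 3) (ex2M v2' w2))))) _))
    => [t x|x|x|x] //=.
  + by field.
  + by field.
  + by field.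
- apply: (ex2_eq (ex2_ext (ex2D (ex2M c (ex2X3 1 u2)) (ex2M d (ex2D (ex2D (ex2X3 1 v2')
     (ex2M (ex2_cst 6) (ex2M (ex2X2 v2') w2))) (ex2X2 w2)))) _))
    => [t x|x|x|x] //=.
  + by field.
  + by field.
  + by field.
- apply: (ex2_eq (ex2_ext (ex2D (ex2M c (ex2X3 2 u2)) (ex2M d (ex2D (ex2D (ex2X3 2 v2')
     (ex2M (ex2_cst 10) (ex2M (ex2X3 0 v2') w2))) (ex2M (ex2_cst 5) (ex2M v2' (ex2X2 w2)))))) _))
    => [t x|x|x|x] //=.
  + by field.
  + by field.
  + by field.
- apply: (ex2_eq (ex2_ext (ex2D (ex2M c (ex2X3 3 u2)) (ex2M d (ex2D (ex2D (ex2D (ex2X3 3 v2')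
     (ex2M (ex2_cst 15) (ex2M (ex2X3 1 v2') w2)))
     (ex2M (ex2_cst 15) (ex2M (ex2X2 v2') (ex2X2 w2)))) (ex2X3 0 w2)))) _))
    => [t x|x|x|x] //=.
  + by field.
  + by field.
  + by field.
Qed.

(** * Three-point laws of the CIR scheme *)

(** Both regimes of the scheme are stored as three weights and three values; a law with fewer atoms
    is padded with zero weights. *)
Definition of3 (T : Type) (a b c : T) (i : 'I_3) : T :=
  match val i with 0%N => a | 1%N => b | _ => c end.

Lemma sum_of3 (R : realType) (F : 'I_3 -> R) :
  \sum_(i < 3) F i = F ord0 + F (lift ord0 ord0) + F ord_max.
Proof.
rewrite !big_ord_recl big_ord0 addr0 addrA.
by congr (_ + _ + F _); apply/val_inj.
Qed.

Lemma forall_I3 (Q : 'I_3 -> Prop) :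
  Q ord0 -> Q (lift ord0 ord0) -> Q ord_max -> forall i, Q i.
Proof.
move=> Q0 Q1 Q2 [[|[|[|//]]] lti].
- by rewrite (_ : Ordinal _ = ord0)//; apply/val_inj.
- by rewrite (_ : Ordinal _ = lift ord0 ord0)//; apply/val_inj.
- by rewrite (_ : Ordinal _ = ord_max)//; apply/val_inj.
Qed.

(* [K] bounds the displacement of the law [p, y] from [x], [B] the error on its
   moments; the sixth moment is compared with 0 and controls the Taylor remainder. *)
Definition good_law (R : realType) (a k s t x K B : R) (p y : 'I_3 -> R) :=
  [/\ forall i, 0 <= p i, \sum_i p i = 1, forall i, `|y i - x| <= K &
   forall j, (0 < j)%N -> (j <= 6)%N ->
    `|\sum_i p i * (y i - x) ^+ j - (mom1 a k s j x * t + mom2 a k s j x * t ^+ 2)|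
      <= B * t ^+ 3].

(** Here [w] is [wstep] without its factor [sqrt 3], so it ranges over -1, 0 and 1. *)
Definition nv_y (R : realType) (a k s t x w : R) : R :=
  let e := expR (- (k * t) / 2) in let cz := (a - s ^+ 2 / 4) * zeta k (t / 2) in
  e * (Num.sqrt (cz + e * x) + s / 2 * Num.sqrt t * (Num.sqrt 3 * w)) ^+ 2 + cz.

Lemma nv_law (R : realType) (a k s : R) :
  exists K m, 0 <= K /\ forall t x, 0 < t -> t <= 1 -> 0 <= x ->
    0 <= (a - s ^+ 2 / 4) * zeta k (t / 2) + expR (- (k * t) / 2) * x ->
    good_law a k s t x (K * (1 + x) ^+ m) (K * (1 + x) ^+ m)
      (of3 (1 / 6) (2 / 3) (1 / 6))
      (of3 (nv_y a k s t x (- 1)) (nv_y a k s t x 0) (nv_y a k s t x 1)).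
Proof.
have [C [m [C0 HC]]] : pb (fun t x => `|nv_delta a k s t x| +
    (`|nv_delta a k s t x + nv_shift k s t| + (1 + `|nv_var a k s t x|))).
  have u := ex2_pb (ex2_nv_delta a k s).
  have v := ex2_pb (ex2D (ex2_nv_delta a k s) (ex2_nv_shift k s)).
  have w := ex2_pb (ex2_nv_var a k s).
  apply: pbD; first exact: pb_abs.
  apply: pbD; first exact: pb_abs.
  by apply: pbD; [exact: pb_cst|exact: pb_abs].
have M j : exists C m, 0 <= C /\ forall t x, 0 < t -> t <= 1 -> 0 <= x ->
    (0 < j)%N -> (j <= 6)%N ->
    `|nv_mom a k s j t x - (mom1 a k s j x * t + mom2 a k s j x * t ^+ 2)|
      <= C * t ^+ 3 * (1 + x) ^+ m.
  have [/andP[j0 j6]|jn] := boolP ((0 < j) && (j <= 6))%N; last first.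
    exists 0, 0%N; split => // t x _ _ _ j0 j6; exfalso.
    by move: jn; rewrite j0 j6.
  have [D [p [D0 H]]] := ex2_remainder (ex2_nv_mom a k s j0 j6).
  by exists D, p; split => // t x t0 t1 x0 _ _; have := H t x t0 t1 x0; rewrite add0r.
have M' j : exists Cm : R * nat, 0 <= Cm.1 /\ forall t x, 0 < t -> t <= 1 -> 0 <= x ->
    (0 < j)%N -> (j <= 6)%N ->
    `|nv_mom a k s j t x - (mom1 a k s j x * t + mom2 a k s j x * t ^+ 2)|
      <= Cm.1 * t ^+ 3 * (1 + x) ^+ Cm.2.
  by have [D [p H]] := M j; exists (D, p).
have [f fP] := choice M'.
(* Summing over the orders gives one constant and one exponent that dominate those of every moment
   and of the displacement. *)
pose K := C + \sum_(j < 7) (f j).1; pose N := (m + \sum_(j < 7) (f j).2)%N.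
have K0 : 0 <= K by rewrite addr_ge0// sumr_ge0// => j _; exact: (fP j).1.
exists K, N; split => // t x t0 t1 x0 z0.
have w1 : 1 <= 1 + x by rewrite lerDl.
have sqt : Num.sqrt t ^+ 2 = t by rewrite sqr_sqrtr// ltW.
have sq3 : Num.sqrt 3 ^+ 2 = 3 :> R by rewrite sqr_sqrtr.
set e := expR (- (k * t) / 2); set cz := (a - s ^+ 2 / 4) * zeta k (t / 2).
have sqz : Num.sqrt (cz + e * x) ^+ 2 = cz + e * x by rewrite sqr_sqrtr.
pose v := nv_delta a k s t x + nv_shift k s t.
pose dd := e * s * Num.sqrt t * Num.sqrt 3 * Num.sqrt (cz + e * x).
have ddE : dd ^+ 2 = nv_var a k s t x.
  by rewrite /dd !exprMn sqt sq3 sqz /nv_var -/e -/cz; ring.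
have y0 : nv_y a k s t x 0 - x = nv_delta a k s t x.
  by rewrite /nv_y mulr0 mulr0 addr0 sqz /nv_delta -/e -/cz; ring.
have yw w : w ^+ 2 = 1 -> nv_y a k s t x w - x = v + w * dd.
  move=> w2; rewrite /nv_y -/e -/cz sqrrD sqz !exprMn sqt sq3 w2 /v /nv_delta
    /nv_shift /dd -/e -/cz.
  by field.
have y1 : nv_y a k s t x 1 - x = v + dd by rewrite yw ?expr1n// mul1r.
have yN : nv_y a k s t x (- 1) - x = v - dd by rewrite yw ?sqrrN ?expr1n// mulN1r.
have wC : C * (1 + x) ^+ m <= K * (1 + x) ^+ N.
  apply: ler_pM => //; rewrite ?exprn_ge0 ?addr_ge0//.
    by rewrite lerDl sumr_ge0// => j _; exact: (fP j).1.
  by rewrite ler_weXn2l// leq_addr.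
have bd := le_trans (HC t x t0 t1 x0) wC.
rewrite ger0_norm ?addr_ge0// -/v in bd.
(* The root [dd] has no expansion in powers of [t], but [r <= 1 + r^2] bounds it by its square,
   which has one. *)
have dd1 : `|dd| <= 1 + `|nv_var a k s t x|.
  rewrite -ddE normrX; have := normr_ge0 dd; move: (`|dd|) => r r0; nra.
split.
- by apply: forall_I3; rewrite /of3 /=; lra.
- by rewrite sum_of3 /of3 /=; field.
- apply: forall_I3; rewrite /of3 /= ?y0 ?y1 ?yN.
  + apply: le_trans bd; apply: le_trans (ler_normB _ _) _.
    by have := normr_ge0 (nv_delta a k s t x); lra.
  + apply: le_trans bd.
    have := normr_ge0 v; have := normr_ge0 (nv_var a k s t x); lra.
  + apply: le_trans bd; apply: le_trans (ler_normD _ _) _.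
    by have := normr_ge0 (nv_delta a k s t x); lra.
- move=> j j0 j6.
  have -> : \sum_i of3 (1 / 6) (2 / 3) (1 / 6) i *
     (of3 (nv_y a k s t x (- 1)) (nv_y a k s t x 0) (nv_y a k s t x 1) i - x) ^+ j =
     nv_mom a k s j t x.
    rewrite sum_of3 /of3 /= y0 y1 yN /nv_mom -/v -ddE.
    by case: j j0 j6 => [//|[|[|[|[|[|[|//]]]]]]] _ _; field.
  apply: le_trans ((fP j).2 t x t0 t1 x0 j0 j6) _.
  rewrite mulrAC ler_wpM2r ?exprn_ge0 ?(ltW t0)//.
  have j7 : (j < 7)%N by [].
  apply: ler_pM => //; rewrite ?exprn_ge0 ?addr_ge0//; first exact: (fP j).1.
    rewrite /K (bigD1 (Ordinal j7))//= addrCA lerDl addr_ge0// sumr_ge0// => i _.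
    exact: (fP i).1.
  by rewrite ler_weXn2l// /N (bigD1 (Ordinal j7))//= addnCA leq_addr.
Qed.

(** * Expectation of a step function of a uniform variable *)

Lemma uniform_prob_ray (R : realType) (p : R) : 0 <= p -> p <= 1 ->
  uniform_prob (@ltr01 R) `]-oo, p]%classic = p%:E.
Proof.
move=> p0 p1; rewrite /uniform_prob integral_uniform_pdf.
have -> : `]-oo, p] `&` `[0, 1] = `[0, p]%classic :> set R.
  apply/seteqP; split => x /=; rewrite !in_itv /=.
    by move=> [xp /andP[x0 x1]]; rewrite x0.
  by move=> /andP[x0 xp]; rewrite xp x0 (le_trans xp).
rewrite (eq_integral (cst 1%E)); last first.
  move=> x; rewrite inE /= in_itv /= => /andP[x0 xp].
  by rewrite /uniform_pdf x0 (le_trans xp p1) subr0 invr1.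
rewrite integral_cst//= mul1e lebesgue_measure_itv /= lte_fin.
case: ltgtP p0 => // [p0 _|<- _]; first by rewrite sube0.
by [].
Qed.

(** The composite [h o U] takes three values and is an explicit combination of the indicators of
    [U <= p] and [U <= q]; integrability and the value of the integral follow for any such [h]. *)
Lemma expectation_step (R : realType) (d : measure_display)
    (Omega : measurableType d) (P : probability Omega R) (U : {RV P >-> R})
    (p q A B C : R) (h : R -> R) :
  uniform01 U -> 0 <= p -> p <= q -> q <= 1 ->
  (forall u, u <= p -> h u = A) -> (forall u, p < u -> u <= q -> h u = B) ->
  (forall u, q < u -> h u = C) ->
  ('E_P[(fun w => h (U w))] = (p * A + (q - p) * B + (1 - q) * C)%R%:E)%E.
Proof.
move=> Uu p0 pq q1 hA hB hC.
pose S (r : R) := U @^-1` `]-oo, r].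
have mS r : measurable (S r).
  by rewrite /S -[X in measurable X]setTI; exact: (measurable_funP U).
have PS r : 0 <= r -> r <= 1 -> P (S r) = r%:E.
  move=> r0 r1; have := Uu `]-oo, r]%classic (measurable_itv _).
  by rewrite uniform_prob_ray//.
have iS r c : P.-integrable setT (fun w => (c * \1_(S r) w)%:E).
  exact: integrableZl (integrable_indic _ (mS r)).
have iC c : P.-integrable setT (fun w : Omega => c%:E).
  exact: finite_measure_integrable_cst.
have -> : (fun w => h (U w)) =
   (fun w => C + ((B - C) * \1_(S q) w + (A - B) * \1_(S p) w)).
  apply/funext => w; rewrite !indicE.
  have mem r : (w \in S r) = (U w <= r).
    by apply/idP/idP; rewrite /S inE /= in_itv.
  rewrite !mem; have [up|pu] := leP (U w) p.
    by rewrite (le_trans up pq) hA//=; ring.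
  by have [uq|qu] := leP (U w) q; [rewrite hB//=|rewrite hC//=]; ring.
rewrite unlock.
under eq_integral do rewrite !EFinD.
rewrite integralD//=; last exact: integrableD.
rewrite integralD//= integral_cst//= probability_setT mule1.
under eq_integral do rewrite EFinM.
rewrite integralZl//; last exact: integrable_indic.
under [X in (_ + (_ + X))%E]eq_integral do rewrite EFinM.
rewrite integralZl//; last exact: integrable_indic.
rewrite !integral_indic// !setIT.
have Pp := PS p p0 (le_trans pq q1); have Pq := PS q (le_trans p0 pq) q1.
transitivity (C%:E + ((B - C)%:E * q%:E + (A - B)%:E * p%:E))%E.
  by congr (_ + (_ * _ + _ * _))%E.
rewrite -!EFinM -!EFinD; congr EFin; ring.
Qed.

(** * The regime below the threshold *)

Lemma zeta_ge0 (R : realType) (k t : R) : 0 <= t -> 0 <= zeta k t.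
Proof.
move=> t0; rewrite /zeta; case: eqP => // /eqP; rewrite neq_lt => /orP[k0|k0].
  rewrite -mulrNN mulr_ge0// ?oppr_ge0 ?invr_le0 ?(ltW k0)//.
  by rewrite subr_le0 -expR0 ler_expR mulNr oppr_ge0 mulr_le0_ge0// ltW.
by rewrite divr_ge0// ?(ltW k0)// subr_ge0 -expR0 ler_expR mulNr oppr_le0 mulr_ge0// ltW.
Qed.

Lemma zeta_le (R : realType) (k : R) :
  exists Z, 0 <= Z /\ forall t, 0 < t -> t <= 1 -> zeta k t <= Z * t.
Proof.
have [_ _ _ [Q [[C [m [C0 QC]]] H]]] := ex2_zeta1 k.
exists (1 + `|k| / 2 + C); split; first by rewrite !addr_ge0// divr_ge0.
move=> t t0 t1; rewrite (H t 0 t0 t1 (lexx 0)).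
have := QC t 0 t0 t1 (lexx 0); rewrite addr0 expr1n mulr1 => Qb.
have kb : - (k / 2) <= `|k| / 2 by have := ler_norm (- k); rewrite normrN; lra.
have Qb' := le_trans (ler_norm _) Qb.
have t2 : t ^+ 2 <= t by rewrite expr2 ler_piMr// ltW.
have t3 : t ^+ 3 <= t by rewrite exprS ler_piMr ?(ltW t0)// exprn_ile1// ltW.
have t20 : 0 <= t ^+ 2 by rewrite exprn_ge0// ltW.
have t30 : 0 <= t ^+ 3 by rewrite exprn_ge0// ltW.
rewrite add0r mul1r !mulrDl mul1r -!addrA lerD2l; apply: lerD.
  apply: le_trans (ler_wpM2r t20 kb) _; rewrite ler_wpM2l//; exact: divr_ge0.
by rewrite mulrC; apply: le_trans (ler_wpM2r t30 Qb') _; rewrite ler_wpM2l.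
Qed.

Lemma expR_mul_le (R : realType) (k t : R) : 0 <= t -> t <= 1 -> expR (k * t) <= expR `|k|.
Proof.
move=> t0 t1; rewrite ler_expR (le_trans (ler_norm _))// normrM (ger0_norm t0).
by rewrite ler_piMr.
Qed.

Lemma cir_K2_le (R : realType) (a k s : R) :
  exists K, 0 <= K /\ forall t, 0 < t -> t <= 1 -> cir_K2 a k s t <= K * t.
Proof.
have [Z [Z0 HZ]] := zeta_le k.
have [s4|s4] := ltP (4 * a) (s ^+ 2); last first.
  exists 0; split => // t _ _; rewrite /cir_K2 ltNge s4 /= !mul0r//.
pose c := s ^+ 2 / 4 - a; have c0 : 0 <= c by rewrite /c; lra.
pose E := expR `|k|; have E0 : 0 <= E := expR_ge0 _.
(* From [(u + v)^2 <= 2 u^2 + 2 v^2] applied to the bracket of the threshold, with [E] bounding the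
   exponentials and [Z t] bounding [zeta]. *)
exists (E * ((1 + 2 * E) * (c * Z) + 3 / 2 * s ^+ 2)); split.
  have := sqr_ge0 s; have := mulr_ge0 c0 Z0; move: (s ^+ 2) (c * Z) => u v v0 u0.
  by rewrite mulr_ge0// addr_ge0// mulr_ge0//; lra.
move=> t t0 t1; rewrite /cir_K2 s4 mul1r -/c.
set A := c * zeta k (t / 2); set e := expR _.
have th0 : 0 < t / 2 by lra.
have th1 : t / 2 <= 1 by lra.
have A0 : 0 <= A by rewrite mulr_ge0// zeta_ge0// ltW.
have AZ : A <= c * Z * t.
  rewrite -mulrA ler_wpM2l//; apply: le_trans (HZ _ th0 th1) _.
  by rewrite ler_wpM2l//; lra.
have e0 : 0 <= e := expR_ge0 _.
have eE : e <= E by rewrite /e -mulrA expR_mul_le// ltW.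
have sA : Num.sqrt (e * A) ^+ 2 = e * A by rewrite sqr_sqrtr// mulr_ge0.
have st : Num.sqrt (3 * t) ^+ 2 = 3 * t by rewrite sqr_sqrtr// mulr_ge0// ltW.
have sq : (Num.sqrt (e * A) + s / 2 * Num.sqrt (3 * t)) ^+ 2 <= 2 * (e * A) + 3 / 2 * s ^+ 2 * t.
  move: (Num.sqrt (e * A)) (Num.sqrt (3 * t)) sA st => u v <- v2.
  rewrite (_ : 3 / 2 * s ^+ 2 * t = s ^+ 2 / 2 * (3 * t)); last by field.
  by rewrite -v2; have := sqr_ge0 (u - s / 2 * v); lra.
rewrite -[leRHS]mulrA; apply: ler_pM => //.
  by rewrite addr_ge0// sqr_ge0.
have eA : e * A <= E * (c * Z * t) by apply: ler_pM.
apply: le_trans (lerD AZ sq) _.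
rewrite (_ : (_ + _) * t = c * Z * t + (2 * (E * (c * Z * t)) + 3 / 2 * s ^+ 2 * t)); last by ring.
by rewrite lerD2l lerD2r ler_wpM2l.
Qed.

Lemma cir_u2_ge (R : realType) (a k s t x : R) : 0 <= a -> 0 <= x -> 0 <= t ->
  cir_u1 a k t x ^+ 2 <= cir_u2 a k s t x.
Proof.
move=> a0 x0 t0; rewrite /cir_u2 lerDl mulr_ge0//.
  by rewrite mulr_ge0 ?sqr_ge0 ?zeta_ge0.
by rewrite addr_ge0 ?divr_ge0 ?mulr_ge0 ?zeta_ge0 ?expR_ge0.
Qed.

(** With [q] the root in [cir_pi], the atoms are [u1 / (1 - q)] and [u1 / (1 + q)], and
    [(1 - q)(1 + q) u2 = u1^2]. Although [1 - q] may be small, the larger atom equals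
    [(1 + q) u2 / u1], and [u2 <= u1^2 + s^2 zeta u1] bounds it by [2 (u1 + s^2 zeta)]. *)
Lemma cir_two_point (R : realType) (a k s t x : R) : 0 <= a -> 0 <= x -> 0 < t ->
  x < cir_K2 a k s t -> exists p y : 'I_3 -> R,
  [/\ [/\ forall i, 0 <= p i, \sum_i p i = 1 &
       forall i, 0 <= y i <= 2 * (cir_u1 a k t x + s ^+ 2 * zeta k t)],
   \sum_i p i * y i = cir_u1 a k t x,
   \sum_i p i * y i ^+ 2 = cir_u2 a k s t x &
   forall (d : measure_display) (Omega : measurableType d)
      (P : probability Omega R) (U : {RV P >-> R}), uniform01 U ->
   forall h : R -> R,
     ('E_P[(fun w => h (cir_phi a k s x t (U w)))] = (\sum_i p i * h (y i))%R%:E)%E].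
Proof.
move=> a0 x0 t0 xK.
have z0 := zeta_ge0 k (ltW t0).
have u10 : 0 <= cir_u1 a k t x by rewrite addr_ge0 ?mulr_ge0 ?expR_ge0.
have u21 := cir_u2_ge k s a0 x0 (ltW t0).
have sz0 : 0 <= s ^+ 2 * zeta k t := mulr_ge0 (sqr_ge0 s) z0.
have u2le : cir_u2 a k s t x <= cir_u1 a k t x ^+ 2 + s ^+ 2 * zeta k t * cir_u1 a k t x.
  rewrite lerD2l (ler_wpM2l sz0)// /cir_u1.
  by have := mulr_ge0 a0 z0; lra.
rewrite /cir_phi leNgt xK /=.
(* When the mean vanishes so does [u2], and the conventional value 0 is the right point mass. *)
have [u1z|u1n] := eqVneq (cir_u1 a k t x) 0.
  exists (of3 1 0 0), (of3 0 0 0); split; last 1 first.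
  - move=> d Omega P U _ h.
    rewrite sum_of3 /of3 /= mul1r !mul0r !addr0.
    exact: expectation_cst.
  - split; first by apply: forall_I3; rewrite /of3 /=.
      by rewrite sum_of3 /of3 /= !addr0.
    by apply: forall_I3; rewrite /of3 /= u1z add0r lexx (mulr_ge0 _ sz0).
  - by rewrite sum_of3 /of3 /= u1z; ring.
  - rewrite sum_of3 /of3 /= expr0n !mulr0 !addr0.
    by apply/eqP; rewrite eq_le; apply/andP; split;
      [apply: le_trans u21; exact: sqr_ge0|apply: le_trans u2le _; rewrite u1z; lra].
have u1p : 0 < cir_u1 a k t x by rewrite lt0r u1n.
have u2p : 0 < cir_u2 a k s t x by apply: lt_le_trans u21; rewrite exprn_gt0.
rewrite /cir_pi; move: u10 u21 u2le u1n u1p u2p.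
move: (cir_u1 a k t x) (cir_u2 a k s t x) => u1 u2 u10 u21 u2le u1n u1p u2p.
set q := Num.sqrt _.
have r1 : u1 ^+ 2 / u2 <= 1 by rewrite ler_pdivrMr// mul1r.
have q0 : 0 <= q := sqrtr_ge0 _.
have q2 : q ^+ 2 = 1 - u1 ^+ 2 / u2 by rewrite sqr_sqrtr// subr_ge0.
have q1 : q < 1.
  rewrite -(@ltr_pXn2r _ 2)// ?nnegrE// expr1n q2 gtrBl divr_gt0// exprn_gt0//.
have qn : 1 - q != 0 by rewrite subr_eq0 gt_eqF.
have qn' : 1 + q != 0 by rewrite gt_eqF//; lra.
have e2 : (1 - q) * (1 + q) * u2 = u1 ^+ 2.
  by rewrite (_ : (1 - q) * (1 + q) = 1 - q ^+ 2); [rewrite q2; field; rewrite gt_eqF|ring].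
have y1E : u1 / (2 * ((1 - q) / 2)) = u1 / (1 - q) by field.
have y2E : u1 / (2 * (1 - (1 - q) / 2)) = u1 / (1 + q).
  by field; rewrite ?qn'//=; apply/eqP => H; move/eqP: qn'; apply; lra.
exists (of3 ((1 - q) / 2) ((1 + q) / 2) 0).
exists (of3 (u1 / (1 - q)) (u1 / (1 + q)) (u1 / (1 + q))).
have y2b : 0 <= u1 / (1 + q) <= 2 * (u1 + s ^+ 2 * zeta k t).
  rewrite divr_ge0//; last lra.
  rewrite ler_pdivrMr; last lra.
  apply: (@le_trans _ _ (u1 * (1 + q))); first by rewrite ler_peMr//; lra.
  by rewrite ler_wpM2r//; lra.
split.
- split; first by apply: forall_I3; rewrite /of3 /=; lra.
    by rewrite sum_of3 /of3 /=; field.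
  apply: forall_I3; rewrite /of3 //=.
  rewrite divr_ge0 ?subr_ge0 ?(ltW q1)//= ler_pdivrMr ?subr_gt0//.
  rewrite -(ler_pM2r u1p) -expr2 -e2.
  have -> : 2 * (u1 + s ^+ 2 * zeta k t) * (1 - q) * u1 =
      (1 - q) * 2 * (u1 ^+ 2 + s ^+ 2 * zeta k t * u1) by ring.
  apply: ler_pM => //; rewrite ?mulr_ge0 ?subr_ge0 ?(ltW q1) ?(ltW u2p)//; first lra.
  by rewrite ler_wpM2l ?subr_ge0 ?(ltW q1)//; lra.
- by rewrite sum_of3 /of3 /=; field; rewrite qn qn'.
- have -> : u2 = u1 ^+ 2 / ((1 - q) * (1 + q)).
    by rewrite -e2; field; rewrite qn qn'.
  by rewrite sum_of3 /of3 /=; field; rewrite qn qn'.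
- move=> d Omega P U Uu h.
  (* Taking 1 as second breakpoint gives the third region, [u > 1], weight zero. *)
  have := @expectation_step _ _ _ P U ((1 - q) / 2) 1 (h (u1 / (1 - q))) (h (u1 / (1 + q)))
    (h (u1 / (1 + q))) (fun u => h ((u <= (1 - q) / 2)%R%:R * (u1 / (2 * ((1 - q) / 2))) +
       ((1 - q) / 2 < u)%R%:R * (u1 / (2 * (1 - (1 - q) / 2))))) Uu.
  have s3 : (1 - q) / 2 * h (u1 / (1 - q)) + (1 - (1 - q) / 2) * h (u1 / (1 + q)) +
      (1 - 1) * h (u1 / (1 + q)) =
      \sum_i of3 ((1 - q) / 2) ((1 + q) / 2) 0 i *
        h (of3 (u1 / (1 - q)) (u1 / (1 + q)) (u1 / (1 + q)) i).
    by rewrite sum_of3 /of3 /=; field.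
  rewrite s3; apply.
  + lra.
  + lra.
  + by [].
  + by move=> u uq; rewrite uq ltNge uq /= mul1r mul0r addr0 y1E.
  + by move=> u uq _; rewrite leNgt uq /= mul1r mul0r add0r y2E.
  + move=> u uq; have uq' : (1 - q) / 2 < u by lra.
    by rewrite leNgt uq' /= mul1r mul0r add0r y2E.
Qed.

Lemma weight_le (R : realType) (C K x : R) m N : 0 <= C -> C <= K -> (m <= N)%N -> 0 <= x ->
  C * (1 + x) ^+ m <= K * (1 + x) ^+ N.
Proof.
move=> C0 CK mN x0; apply: ler_pM => //; first by rewrite exprn_ge0// addr_ge0.
by rewrite ler_weXn2l// lerDl.
Qed.

Lemma ex2_cir_u1 (R : realType) (a k : R) :
  ex2 (fun t x => cir_u1 a k t x) id (fun x => a - k * x)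
    (fun x => k ^+ 2 / 2 * x - a * k / 2).
Proof.
have e := ex2_expR (- k).
apply: (ex2_eq (ex2D (ex2M (ex2_x R) e) (ex2M (ex2_cst a) (ex2_zeta1 k)))) => x.
- by ring.
- by ring.
- by field.
Qed.

Lemma ex2_cir_mean (R : realType) (a k s : R) :
  ex2 (fun t x => cir_u1 a k t x - x) (fun=> 0) (mom1 a k s 1) (mom2 a k s 1).
Proof.
apply: (ex2_eq (ex2D (ex2_cir_u1 a k) (ex2N (ex2_x R)))) => x.
- by ring.
- by rewrite /=; ring.
- by rewrite /=; field.
Qed.

Lemma ex2_cir_var (R : realType) (a k s : R) :
  ex2 (fun t x => cir_u2 a k s t x - 2 * x * cir_u1 a k t x + x ^+ 2)
    (fun=> 0) (mom1 a k s 2) (mom2 a k s 2).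
Proof.
have m := ex2_cir_mean a k s.
have m' := ex2_eq m (fun=> erefl) (fun=> erefl) (fun=> erefl).
have e := ex2_expR (- k).
have z := ex2_zeta1 k.
have v := ex2M (ex2M (ex2_cst (s ^+ 2)) z)
   (ex2D (ex2M (ex2M (ex2_cst a) z) (ex2_cst (2^-1))) (ex2M (ex2_x R) e)).
(* The second moment about [x] is the squared bias [(u1 - x)^2] plus the variance [u2 - u1^2]. *)
apply: (ex2_eq (ex2_ext (ex2D (ex2X2 m) v) _)) => [t x|x|x|x] /=.
- by rewrite /cir_u2; ring.
- by ring.
- by ring.
- by field.
Qed.

(** From order three on, both sides are [O(t^3)]: the moments because [|y - x| <= L t], the
    prescribed values because [mom1] vanishes and [mom2] carries a factor [x], itself [O(t)]
    here. *)
Lemma small_law (R : realType) (a k s : R) : 0 <= a ->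
  exists K m, 0 <= K /\ forall t x, 0 < t -> t <= 1 -> 0 <= x -> x < cir_K2 a k s t ->
    forall p y : 'I_3 -> R, (forall i, 0 <= p i) -> \sum_i p i = 1 ->
    (forall i, 0 <= y i <= 2 * (cir_u1 a k t x + s ^+ 2 * zeta k t)) ->
    \sum_i p i * y i = cir_u1 a k t x ->
    \sum_i p i * y i ^+ 2 = cir_u2 a k s t x ->
    good_law a k s t x (K * (1 + x) ^+ m) (K * (1 + x) ^+ m) p y.
Proof.
move=> a0.
have [Z [Z0 HZ]] := zeta_le k.
have [K2 [K20 HK2]] := cir_K2_le a k s.
pose E := expR `|k|; have E0 : 0 <= E := expR_ge0 _.
(* The bound [2 (u1 + s^2 zeta)] on the atoms, with [x <= K2 t] inserted in [u1], plus [K2] for [x]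
   itself. *)
pose L := 2 * ((K2 * E + a * Z) + s ^+ 2 * Z) + K2.
have sZ0 : 0 <= s ^+ 2 * Z by rewrite (mulr_ge0 (sqr_ge0 s)).
have L0 : 0 <= L by rewrite addr_ge0// mulr_ge0// addr_ge0// addr_ge0// mulr_ge0.
have [C1 [m1 [C10 H1]]] := ex2_remainder (ex2_cir_mean a k s).
have [C2 [m2 [C20 H2]]] := ex2_remainder (ex2_cir_var a k s).
(* The prescribed third and fourth moment coefficients divided by [x]. *)
pose r3 (x : R) := 3 * ((a - k * x) * s ^+ 2 + s ^+ 4 / 2).
pose r4 (x : R) := 3 * s ^+ 4 * x.
have p3 : pb (fun _ => r3) by rewrite /r3; pb_tac.
have p4 : pb (fun _ => r4) by rewrite /r4; pb_tac.
have [C3 [m3 [C30 H3]]] := pbD (pb_abs p3) (pb_abs p4).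
have P0 : 0 <= (1 + L) ^+ 6 by rewrite exprn_ge0// addr_ge0.
exists (C1 + C2 + K2 * C3 + (1 + L) ^+ 6 + L), (m1 + m2 + m3)%N.
have KC : 0 <= K2 * C3 by rewrite mulr_ge0.
split; first by do !apply: addr_ge0 => //.
move=> t x t0 t1 x0 xK p y p0 p1 yb py py2.
set K := (X in X * _); set N := (m1 + m2 + m3)%N.
have t30 : 0 <= t ^+ 3 by rewrite exprn_ge0// ltW.
have xt : x <= K2 * t by apply: le_trans (HK2 t t0 t1); exact: ltW.
have Zt := HZ t t0 t1; have z0 := zeta_ge0 k (ltW t0).
have eE : expR (- k * t) <= E.
  by rewrite /E -(normrN k) expR_mul_le// ltW.
have yL i : `|y i - x| <= L * t.
  have /andP[yi0 yi] := yb i.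
  have u1 : cir_u1 a k t x <= (K2 * E + a * Z) * t.
    rewrite mulrDl; apply: lerD.
      by rewrite mulrAC; apply: ler_pM => //; exact: expR_ge0.
    by rewrite -mulrA ler_wpM2l.
  have s1 : s ^+ 2 * zeta k t <= s ^+ 2 * Z * t by rewrite -mulrA (ler_wpM2l (sqr_ge0 s)).
  have Lt : L * t = 2 * ((K2 * E + a * Z) * t + s ^+ 2 * Z * t) + K2 * t.
    by rewrite /L; ring.
  have K2t : 0 <= K2 * t by rewrite mulr_ge0// ltW.
  by rewrite ler_norml Lt; apply/andP; split; lra.
have yLL i : `|y i - x| <= L.
  by apply: le_trans (yL i) _; rewrite ler_piMr.
have wK C m : 0 <= C -> C <= K -> (m <= N)%N -> C * (1 + x) ^+ m <= K * (1 + x) ^+ N.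
  by move=> C0 CK mN; exact: weight_le.
have CK : [/\ C1 <= K, C2 <= K, K2 * C3 + (1 + L) ^+ 6 <= K & L <= K].
  by rewrite /K; split; lra.
have [C1K C2K C3K LK] := CK.
split => // [i|j j0 j6].
  apply: le_trans (yLL i) _; rewrite -[leLHS]mulr1 -(expr0 (1 + x)); exact: wK.
(* The power [(1 + L)^6] dominates [L^j] for all orders up to six, and [t^j <= t^3] since
   [t <= 1]. *)
have rem : (2 < j)%N -> `|\sum_i p i * (y i - x) ^+ j| <= (1 + L) ^+ 6 * t ^+ 3.
  move=> j2; apply: le_trans (ler_norm_sum _ _ _) _.
  rewrite -[leRHS]mul1r -[X in _ <= X * _]p1 mulr_suml; apply: ler_sum => i _.
  rewrite normrM (ger0_norm (p0 i)) ler_wpM2l// normrX.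
  have Lt0 : 0 <= L * t by rewrite mulr_ge0// ltW.
  apply: (@le_trans _ _ ((L * t) ^+ j)); first by rewrite lerXn2r ?nnegrE.
  rewrite exprMn; apply: ler_pM => //; rewrite ?exprn_ge0 ?(ltW t0)//.
    apply: (@le_trans _ _ ((1 + L) ^+ j)); first by apply: lerXn2r; rewrite ?nnegrE; move: L0; move: (L) => l; lra.
    by apply: ler_weXn2l => //; rewrite lerDl.
  by rewrite ler_wiXn2l// ltW.
have rem' (r : R -> R) : (2 < j)%N -> `|r x| <= C3 * (1 + x) ^+ m3 ->
   mom2 a k s j x = x * r x ->
   `|\sum_i p i * (y i - x) ^+ j - (0 * t + mom2 a k s j x * t ^+ 2)| <= K * (1 + x) ^+ N * t ^+ 3.
  move=> j2 rb ->; rewrite mul0r add0r.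
  have B2 : `|x * r x * t ^+ 2| <= K2 * C3 * (1 + x) ^+ m3 * t ^+ 3.
    rewrite 2!normrM (ger0_norm x0) normrX (ger0_norm (ltW t0)).
    have -> : K2 * C3 * (1 + x) ^+ m3 * t ^+ 3 = (K2 * t) * (C3 * (1 + x) ^+ m3) * t ^+ 2 by ring.
    by rewrite ler_wpM2r ?exprn_ge0 ?(ltW t0)//; apply: ler_pM.
  apply: le_trans (ler_normB _ _) _; apply: le_trans (lerD (rem j2) B2) _.
  rewrite -mulrDl ler_wpM2r// addrC.
  apply: (@le_trans _ _ ((K2 * C3 + (1 + L) ^+ 6) * (1 + x) ^+ m3)).
    rewrite mulrDl lerD2l ler_peMr// exprn_ege1// lerDl//.
  by apply: wK => //; [rewrite addr_ge0|rewrite leq_addl].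
have H3x := H3 t x t0 t1 x0.
have H3' : `|r3 x| <= C3 * (1 + x) ^+ m3 /\ `|r4 x| <= C3 * (1 + x) ^+ m3.
  move: H3x; rewrite ger0_norm ?addr_ge0//.
  by have := normr_ge0 (r3 x); have := normr_ge0 (r4 x); lra.
case: j j0 j6 rem rem' => [//|[|[|[|[|[|[|//]]]]]]] _ _ rem rem'.
- have -> : \sum_i p i * (y i - x) ^+ 1 = cir_u1 a k t x - x.
    rewrite -py -[X in _ = _ - X]mul1r -p1 mulr_suml -sumrB.
    by apply: eq_bigr => i _; rewrite expr1 mulrBr.
  have := H1 t x t0 t1 x0; rewrite add0r => /le_trans; apply.
  by rewrite mulrAC ler_wpM2r// wK// /N -addnA leq_addr.
- have -> : \sum_i p i * (y i - x) ^+ 2 = cir_u2 a k s t x - 2 * x * cir_u1 a k t x + x ^+ 2.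
    rewrite -py -py2 -[X in _ = _ + X]mul1r -[X in _ = _ + X * _]p1 mulr_suml mulr_sumr -sumrB -big_split /=.
    by apply: eq_bigr => i _; ring.
  have := H2 t x t0 t1 x0; rewrite add0r => /le_trans; apply.
  by rewrite mulrAC ler_wpM2r// wK// /N addnAC leq_addl.
- by apply: (rem' r3) => //; [exact: H3'.1|rewrite /= /r3; ring].
- by apply: (rem' r4) => //; [exact: H3'.2|rewrite /= /r4; ring].
- apply: (rem' (fun=> 0)) => //; last by rewrite /= mulr0.
  by rewrite normr0 mulr_ge0 ?exprn_ge0 ?addr_ge0.
- apply: (rem' (fun=> 0)) => //; last by rewrite /= mulr0.
  by rewrite normr0 mulr_ge0 ?exprn_ge0 ?addr_ge0.
Qed.

Lemma good_law_le (R : realType) (a k s t x K B K' B' : R) (p y : 'I_3 -> R) : 0 <= t ->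
  K <= K' -> B <= B' -> good_law a k s t x K B p y -> good_law a k s t x K' B' p y.
Proof.
move=> t0 KK BB [p0 p1 yb H]; split => // [i|j j0 j6].
  exact: le_trans (yb i) KK.
by apply: le_trans (H j j0 j6) _; rewrite ler_wpM2r// exprn_ge0.
Qed.

Theorem cir_law (R : realType) (a k s : R) : 0 <= a ->
  exists K m, 0 <= K /\ forall t x, 0 < t -> t <= 1 -> 0 <= x ->
    exists p y : 'I_3 -> R,
    good_law a k s t x (K * (1 + x) ^+ m) (K * (1 + x) ^+ m) p y /\
    forall (d : measure_display) (Omega : measurableType d)
      (P : probability Omega R) (U : {RV P >-> R}), uniform01 U ->
    forall h : R -> R,
      ('E_P[(fun w => h (cir_phi a k s x t (U w)))] = (\sum_i p i * h (y i))%R%:E)%E.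
Proof.
move=> a0.
have [K [m [K0 HK]]] := nv_law a k s.
have [L [n [L0 HL]]] := @small_law R a k s a0.
exists (K + L), (m + n)%N; split; first exact: addr_ge0.
move=> t x t0 t1 x0; have [xK|xK] := leP (cir_K2 a k s t) x; last first.
  have [p [y [[p0 p1 yb] py py2 HE]]] := cir_two_point a0 x0 t0 xK.
  exists p, y; split => //.
  have W : L * (1 + x) ^+ n <= (K + L) * (1 + x) ^+ (m + n).
    by apply: weight_le => //; rewrite ?lerDr ?leq_addl.
  exact: (good_law_le (ltW t0) W W (HL t x t0 t1 x0 xK p y p0 p1 yb py py2)).
have W : K * (1 + x) ^+ m <= (K + L) * (1 + x) ^+ (m + n).
  by apply: weight_le => //; rewrite ?lerDl ?leq_addr.
have z0 : 0 <= (a - s ^+ 2 / 4) * zeta k (t / 2) + expR (- (k * t) / 2) * x.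
  have th0 : 0 <= t / 2 by rewrite divr_ge0// ltW.
  have zz := zeta_ge0 k th0; have ee := expR_ge0 (- (k * t) / 2).
  (* The threshold keeps the radicand nonnegative. If [s^2 <= 4 a] both terms are; otherwise
     multiplying [K2 <= x] by [exp(- k t / 2)] leaves the radicand at least a square. *)
  have [s4|s4] := leP (s ^+ 2) (4 * a).
    by rewrite addr_ge0// mulr_ge0//; lra.
  move: xK; rewrite /cir_K2 s4 mul1r => xK.
  have e1 : expR (- (k * t) / 2) * expR (k * t / 2) = 1.
    by rewrite -expRD (_ : _ + _ = 0) ?expR0//; field.
  have := ler_wpM2l ee xK; rewrite [X in X <= _]mulrA e1 mul1r.
  set q := (X in _ + X <= _).
  have : 0 <= q by rewrite sqr_ge0.
  lra.
exists (of3 (1 / 6) (2 / 3) (1 / 6)), (of3 (nv_y a k s t x (- 1)) (nv_y a k s t x 0) (nv_y a k s t x 1)).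
split; first exact: (good_law_le (ltW t0) W W (HK t x t0 t1 x0 z0)).
move=> d Omega P U Uu h.
have := @expectation_step _ _ _ P U (1 / 6) (5 / 6) (h (nv_y a k s t x (- 1)))
   (h (nv_y a k s t x 0)) (h (nv_y a k s t x 1)) (fun u => h (cir_phi a k s x t u)) Uu.
have -> : 1 / 6 * h (nv_y a k s t x (- 1)) + (5 / 6 - 1 / 6) * h (nv_y a k s t x 0) +
   (1 - 5 / 6) * h (nv_y a k s t x 1) =
   \sum_i of3 (1 / 6) (2 / 3) (1 / 6) i *
     h (of3 (nv_y a k s t x (- 1)) (nv_y a k s t x 0) (nv_y a k s t x 1) i).
  by rewrite sum_of3 /of3 /=; field.
apply.
- by lra.
- by lra.
- by lra.
- move=> u u6; rewrite /cir_phi xK /wstep u6 ltNge (le_trans u6) /=; last lra.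
  by rewrite sub0r.
- move=> u u6 u5; rewrite /cir_phi xK /wstep (leNgt u) u6 ltNge u5 /=.
  by rewrite subr0.
- move=> u u5; rewrite /cir_phi xK /wstep u5 (leNgt u) (lt_trans _ u5) /=; last lra.
  by rewrite subr0.
Qed.

(** * From one dimension to several *)

(** Derivative along [(1, ..., 1)], the direction of the lines [y |-> A_x(y)]. *)
Definition dirD (R : realType) n (f : 'rV[R]_n -> R) : 'rV[R]_n -> R :=
  fun x => \sum_(i < n) partial i f x.

Lemma tame_dirD (R : realType) n I (F : I -> 'rV_n -> R) :
  @tame R n I F -> tame (fun i => dirD (F i)).
Proof. by move=> TF; apply: tame_sum => j; exact: tame_partial. Qed.

Lemma tame_iter_dirD (R : realType) n I (F : I -> 'rV_n -> R) j :
  @tame R n I F -> tame (fun i => iter j (@dirD R n) (F i)).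
Proof. by move=> TF; elim: j => [|j IH] //=; exact: tame_dirD. Qed.

Lemma dirD2 (R : realType) n I (F : I -> 'rV_n -> R) i x : @tame R n I F ->
  dirD (dirD (F i)) x = \sum_(l < n) \sum_(j < n) partial l (partial j (F i)) x.
Proof.
move=> TF; apply: eq_bigr => l _.
have E : dirD (F i) = \sum_(j < n) partial j (F i).
  by apply/funext => y; rewrite fct_sumE.
rewrite [LHS]/partial E derive_sum// => j.
exact: (@tame_derivable _ _ _ _ i _ _ (tame_partial j TF)).
Qed.

Lemma kernelG0_gt0 (R : realType) n (rho gamma : 'I_n -> R) :
  (0 < n)%N -> (forall i, 0 < gamma i) -> 0 < kernelG rho gamma 0.
Proof.
case: n rho gamma => // n rho gamma _ g0.
rewrite /kernelG big_ord_recl ltr_pwDl ?mulr_gt0 ?expR_gt0//.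
by rewrite sumr_ge0// => i _; rewrite mulr_ge0 ?expR_ge0// ltW.
Qed.

Lemma agg_Amap (R : realType) n (rho gamma : 'I_n -> R) (x0 : R) x y :
  kernelG rho gamma 0 != 0 -> agg gamma x0 (Amap rho gamma x0 x y) = y.
Proof.
move=> G0; rewrite {1}/agg.
under eq_bigr do rewrite mxE mulrDr.
rewrite big_split /= -mulr_suml.
have -> : \sum_(i < n) gamma i = kernelG rho gamma 0.
  by apply: eq_bigr => i _; rewrite mulr0 expR0 mulr1.
by rewrite addrA -/(agg gamma x0 x) mulrC divfK// addrC subrK.
Qed.

Lemma Amap_agg (R : realType) n (rho gamma : 'I_n -> R) (x0 : R) x :
  Amap rho gamma x0 x (agg gamma x0 x) = x.
Proof. by apply/rowP => i; rewrite mxE subrr mul0r addr0. Qed.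

Lemma Amap_norm (R : realType) n (rho gamma : 'I_n -> R) (x0 : R) x y :
  0 < kernelG rho gamma 0 ->
  `|Amap rho gamma x0 x y| <= `|x| + `|y - agg gamma x0 x| / kernelG rho gamma 0.
Proof.
move=> G0; apply: rV_norm_le => [|j]; first by rewrite addr_ge0// divr_ge0// ltW.
rewrite mxE (le_trans (ler_normD _ _))// normrM normfV (gtr0_norm G0) lerD2r.
exact: coord_le_norm.
Qed.

Lemma is_derive_Amap (R : realType) n I (F : I -> 'rV_n -> R) i
    (rho gamma : 'I_n -> R) (x0 : R) x (y : R) : @tame R n I F ->
  is_derive y 1 (fun y => F i (Amap rho gamma x0 x y))
    (dirD (F i) (Amap rho gamma x0 x y) / kernelG rho gamma 0).
Proof.
move=> TF; set G0 := kernelG _ _ _.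
have d := @is_derive_curve R n (F i) (Amap rho gamma x0 x) (\row_j G0^-1) y
  (fun j x => @tame_derivable _ _ _ _ i j x TF)
  (fun j => @tame_continuous _ _ _ _ i (tame_partial j TF)).
have -> : dirD (F i) (Amap rho gamma x0 x y) / G0 =
   \sum_(l < n) (\row_j G0^-1 : 'rV_n) 0 l * partial l (F i) (Amap rho gamma x0 x y).
  by rewrite mulrC mulr_sumr; apply: eq_bigr => l _; rewrite mxE.
apply: d => l; rewrite mxE.
have d1 := is_deriveD (is_derive_cst (x 0 l - agg gamma x0 x / G0) y 1)
  (is_deriveZ (G0^-1) (is_derive_id y 1)).
apply: (is_derive_ext d1) => [z|]; last by rewrite add0r [_%:A]mulr1.
rewrite mxE -/G0; change (x 0 l - agg gamma x0 x / G0 + G0^-1 * z = x 0 l + (z - agg gamma x0 x) / G0); ring.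
Qed.

(** The [j]-th derivative of [y |-> f (A_x(y))]: the line has velocity [(1, ..., 1) / G(0)], whence
    the power of [G(0)]. *)
Definition linef (R : realType) n (rho gamma : 'I_n -> R) (x0 : R) (f : 'rV[R]_n -> R)
    (x : 'rV[R]_n) (j : nat) (y : R) : R :=
  iter j (@dirD R n) f (Amap rho gamma x0 x y) / kernelG rho gamma 0 ^+ j.

Lemma is_derive_linef (R : realType) n I (F : I -> 'rV_n -> R) i
    (rho gamma : 'I_n -> R) (x0 : R) x j (y : R) : @tame R n I F ->
  is_derive y 1 (linef rho gamma x0 (F i) x j) (linef rho gamma x0 (F i) x j.+1 y).
Proof.
move=> TF; set G0 := kernelG rho gamma 0.
have d := is_deriveZ (G0 ^+ j)^-1
  (@is_derive_Amap R n I _ i rho gamma x0 x y (tame_iter_dirD j TF)).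
apply: (is_derive_ext d) => [z|]; first by rewrite /linef mulrC.
rewrite /linef /= /GRing.scale /= exprS invfM -/G0; ring.
Qed.

(** A derivative along [(1, ..., 1)] is [G(0)] times a derivative in [y], and the aggregate of
    [A_x(y)] is [y]: this is where the rescaled parameters come from. *)
Lemma L2_linef (R : realType) n I (F : I -> 'rV_n -> R) i
    (rho gamma : 'I_n -> R) (x0 a k sigma : R) x y : @tame R n I F ->
  kernelG rho gamma 0 != 0 ->
  let G0 := kernelG rho gamma 0 in let g := linef rho gamma x0 (F i) x in
  L2 gamma x0 a k sigma (F i) (Amap rho gamma x0 x y) =
  (G0 * a - G0 * k * y) * g 1%N y + (G0 * sigma) ^+ 2 / 2 * y * g 2%N y.
Proof.
move=> TF G0n /=; rewrite /L2 agg_Amap// -dirD2// -/(dirD _ _) /linef /=.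
by field.
Qed.

(** With [g j] the [j]-th derivative of [g 0], these are the CIR generator applied to [g 0] and its
    first two derivatives, which make the square of the generator explicit. *)
Definition cirD0 (R : realType) (a k s : R) (g : nat -> R -> R) (y : R) : R :=
  (a - k * y) * g 1%N y + s ^+ 2 / 2 * y * g 2%N y.

Definition cirD1 (R : realType) (a k s : R) (g : nat -> R -> R) (y : R) : R :=
  - k * g 1%N y + (a - k * y + s ^+ 2 / 2) * g 2%N y + s ^+ 2 / 2 * y * g 3%N y.

Definition cirD2 (R : realType) (a k s : R) (g : nat -> R -> R) (y : R) : R :=
  - (2 * k) * g 2%N y + (a - k * y + s ^+ 2) * g 3%N y + s ^+ 2 / 2 * y * g 4%N y.

Lemma is_derive_affM (R : realType) (b c : R) (g dg : R -> R) (y : R) :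
  is_derive y 1 g (dg y) ->
  is_derive y 1 (fun y => (b + c * y) * g y) (c * g y + (b + c * y) * dg y).
Proof.
move=> gd.
have d1 := is_deriveD (is_derive_cst b y 1) (is_deriveZ c (is_derive_id y 1)).
have d := is_deriveM d1 gd.
apply: (is_derive_ext d) => [z|]; first by [].
rewrite add0r [c%:A]mulr1; change ((b + c * y) * dg y + g y * c = c * g y + (b + c * y) * dg y); ring.
Qed.

Lemma is_derive_cirD0 (R : realType) (a k s : R) (g : nat -> R -> R) (y : R) :
  (forall j (y : R), is_derive y 1 (g j) (g j.+1 y)) ->
  is_derive y 1 (cirD0 a k s g) (cirD1 a k s g y).
Proof.
move=> gd.
have d := is_deriveD (is_derive_affM a (- k) (gd 1%N y))
  (is_derive_affM 0 (s ^+ 2 / 2) (gd 2%N y)).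
apply: (is_derive_ext d) => [z|].
  by rewrite /cirD0 !fctE; ring.
by rewrite /cirD1; ring.
Qed.

Lemma is_derive_cirD1 (R : realType) (a k s : R) (g : nat -> R -> R) (y : R) :
  (forall j (y : R), is_derive y 1 (g j) (g j.+1 y)) ->
  is_derive y 1 (cirD1 a k s g) (cirD2 a k s g y).
Proof.
move=> gd.
have d := is_deriveD (is_deriveD (is_derive_affM (- k) 0 (gd 1%N y))
  (is_derive_affM (a + s ^+ 2 / 2) (- k) (gd 2%N y)))
  (is_derive_affM 0 (s ^+ 2 / 2) (gd 3%N y)).
apply: (is_derive_ext d) => [z|].
  by rewrite /cirD1 !fctE; ring.
by rewrite /cirD2; field.
Qed.

(** The previous formula is applied to [L2 f] in place of [f]; the derivatives of [L2 f] along the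
    line are read off in one variable by uniqueness of the derivative. *)
Lemma L2_sqr_linef (R : realType) n I (F : I -> 'rV_n -> R) i
    (rho gamma : 'I_n -> R) (x0 a k sigma : R) x y : @tame R n I F ->
  kernelG rho gamma 0 != 0 ->
  let G0 := kernelG rho gamma 0 in let g := linef rho gamma x0 (F i) x in
  L2 gamma x0 a k sigma (L2 gamma x0 a k sigma (F i)) (Amap rho gamma x0 x y) =
  (G0 * a - G0 * k * y) * cirD1 (G0 * a) (G0 * k) (G0 * sigma) g y +
  (G0 * sigma) ^+ 2 / 2 * y * cirD2 (G0 * a) (G0 * k) (G0 * sigma) g y.
Proof.
move=> TF G0n G0 g.
pose H i := L2 gamma x0 a k sigma (F i).
have TH : tame H := tame_L2 gamma x0 a k sigma TF.
have gd j (z : R) : is_derive z 1 (g j) (g j.+1 z) by exact: is_derive_linef.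
have E0 : linef rho gamma x0 (H i) x 0 = cirD0 (G0 * a) (G0 * k) (G0 * sigma) g.
  apply/funext => z; rewrite /linef expr0 divr1 /=.
  exact: (L2_linef i x0 a k sigma x z TF G0n).
have E1 : linef rho gamma x0 (H i) x 1 = cirD1 (G0 * a) (G0 * k) (G0 * sigma) g.
  apply/funext => z.
  have [_ <-] := is_derive_linef i rho gamma x0 x 0 z TH.
  by rewrite E0; have [_ ->] := is_derive_cirD0 (G0 * a) (G0 * k) (G0 * sigma) z gd.
have E2 : linef rho gamma x0 (H i) x 2 = cirD2 (G0 * a) (G0 * k) (G0 * sigma) g.
  apply/funext => z.
  have [_ <-] := is_derive_linef i rho gamma x0 x 1 z TH.
  by rewrite E1; have [_ ->] := is_derive_cirD1 (G0 * a) (G0 * k) (G0 * sigma) z gd.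
by rewrite (L2_linef i x0 a k sigma x y TH G0n) -/G0 E1 E2.
Qed.

(** The factor 6 counts one Taylor remainder and five moment errors, each at most [M B t^3]. *)
Lemma cir_weak_expansion (R : realType) (a k s t x K B M : R) (p y : 'I_3 -> R)
    (g : nat -> R -> R) : 0 <= t -> 0 <= B ->
  (forall j (y : R), is_derive y 1 (g j) (g j.+1 y)) ->
  (forall j z, (j <= 6)%N -> `|z - x| <= K -> `|g j z| <= M) ->
  good_law a k s t x K B p y ->
  `|\sum_i p i * g 0%N (y i) - (g 0%N x + t * cirD0 a k s g x + t ^+ 2 / 2 *
     ((a - k * x) * cirD1 a k s g x + s ^+ 2 / 2 * x * cirD2 a k s g x))|
  <= 6 * (M * B * t ^+ 3).
Proof.
move=> t0 B0 gd gM [p0 p1 yK mom].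
have K0 : 0 <= K := le_trans (normr_ge0 _) (yK ord0).
have gx j : (j <= 6)%N -> `|g j x| <= M.
  by move=> j6; apply: gM => //; rewrite subrr normr0.
have M0 : 0 <= M := le_trans (normr_ge0 _) (gx 0%N isT).
pose m j := \sum_i p i * (y i - x) ^+ j.
have main : `|\sum_i p i * g 0%N (y i) - \sum_(j < 6) g j x * (m j / j`!%:R)| <= M * B * t ^+ 3.
  have -> : \sum_i p i * g 0%N (y i) - \sum_(j < 6) g j x * (m j / j`!%:R) =
     \sum_i p i * (g 0%N (y i) - \sum_(j < 6) g j x * ((y i - x) ^+ j / j`!%:R)).
    under [RHS]eq_bigr do rewrite mulrBr.
    rewrite sumrB; congr (_ - _).
    under [RHS]eq_bigr do rewrite mulr_sumr.
    rewrite exchange_big /=; apply: eq_bigr => j _.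
    rewrite /m mulr_suml mulr_sumr; apply: eq_bigr => i _; ring.
  apply: le_trans (ler_norm_sum _ _ _) _.
  (* The prescribed sixth moment is 0, so the moment estimate at [j = 6] bounds the sixth moment
     itself. *)
  apply: (@le_trans _ _ (M * \sum_i p i * (y i - x) ^+ 6)); last first.
    rewrite -mulrA ler_wpM2l//; have := mom 6%N isT isT.
    by rewrite /= !mul0r addr0 subr0 => /(le_trans (ler_norm _)).
  rewrite mulr_sumr; apply: ler_sum => i _.
  rewrite normrM (ger0_norm (p0 i)) mulrCA ler_wpM2l//.
  have := @taylor_bound R 6 g x (y i - x) M gd.
  rewrite (addrC x (y i - x)) subrK -normrX [`|_ ^+ 6|]ger0_norm ?exprn_even_ge0//.
  apply=> u /andP[u0 u1]; apply: gM => //.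
  rewrite addrAC subrr add0r normrM ger0_norm//.
  by apply: le_trans (yK i); rewrite ler_piMl.
pose T j := mom1 a k s j x * t + mom2 a k s j x * t ^+ 2.
have step j : (0 < j)%N -> (j <= 6)%N -> `|g j x * ((m j - T j) / j`!%:R)| <= M * B * t ^+ 3.
  move=> j0 j6; rewrite normrM -mulrA; apply: ler_pM => //; first exact: gx.
  rewrite normrM normfV; apply: (@le_trans _ _ `|m j - T j|); last exact: mom.
  rewrite ler_pdivrMr ?normr_gt0 ?pnatr_eq0 -?lt0n ?fact_gt0//.
  by rewrite ler_peMr// ger0_norm// ler1n fact_gt0.
(* Pairing the prescribed moments [T j] with [g j x / j!] for [j = 1..5] reproduces exactly the
   generator terms in [t] and [t^2]. *)
have -> : \sum_i p i * g 0%N (y i) - (g 0%N x + t * cirD0 a k s g x + t ^+ 2 / 2 *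
     ((a - k * x) * cirD1 a k s g x + s ^+ 2 / 2 * x * cirD2 a k s g x)) =
  (\sum_i p i * g 0%N (y i) - \sum_(j < 6) g j x * (m j / j`!%:R)) +
  \sum_(j < 5) g j.+1 x * ((m j.+1 - T j.+1) / j.+1`!%:R).
  have m00 : m 0%N = 1.
    by rewrite /m -[RHS]p1; apply: eq_bigr => i _; rewrite expr0 mulr1.
  rewrite !big_ord_recl !big_ord0 /= /bump /= m00 /T /cirD0 /cirD1 /cirD2 /=.
  by rewrite !factS fact0; field.
have -> : 6 * (M * B * t ^+ 3) = M * B * t ^+ 3 + \sum_(j < 5) M * B * t ^+ 3.
  by rewrite sumr_const card_ord -mulr_natl; ring.
apply: le_trans (ler_normD _ _) _; apply: lerD => //.
apply: le_trans (ler_norm_sum _ _ _) _; apply: ler_sum => j _.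
by apply: step => //; case: j => [[|[|[|[|[|]]]]]].
Qed.

Lemma agg_le (R : realType) n (gamma : 'I_n -> R) (x0 : R) x : (forall i, 0 < gamma i) ->
  agg gamma x0 x <= x0 + (\sum_(i < n) gamma i) * `|x|.
Proof.
move=> g0; rewrite lerD2l mulr_suml; apply: ler_sum => i _.
by rewrite ler_wpM2l ?(ltW (g0 i))// (le_trans (ler_norm _))// coord_le_norm.
Qed.

Lemma pb_sum (R : realType) (J : Type) (r : seq J) (F : J -> R -> R -> R) :
  (forall j, pb (F j)) -> pb (fun t x => \sum_(j <- r) F j t x).
Proof.
move=> pF; elim: r => [|j r IH].
  by under eq_fun do under eq_fun do rewrite big_nil; exact: pb_cst.
by under eq_fun do under eq_fun do rewrite big_cons; exact: pbD.
Qed.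

(** The expectation is exhibited as a real number [e], so that the later estimates take place in [R]
    and not in the extended reals. *)
Lemma psi2_weak (R : realType) n I (F : I -> 'rV[R]_n -> R) (rho gamma : 'I_n -> R)
    (x0 a k sigma : R) :
  (0 < n)%N -> (forall i, 0 < gamma i) -> 0 <= x0 -> 0 <= a -> tame F ->
  exists C m, 0 <= C /\
    forall i (d : measure_display) (Omega : measurableType d)
      (P : probability Omega R) (U : {RV P >-> R}), uniform01 U ->
    forall t x, 0 < t -> t <= 1 -> 0 <= agg gamma x0 x ->
    exists2 e : R, 'E_P[(fun w => F i (psi2 rho gamma x0 a k sigma x t (U w)))]%E = e%:E &
     `|e - (F i x + t * L2 gamma x0 a k sigma (F i) x +
        t ^+ 2 / 2 * L2 gamma x0 a k sigma (L2 gamma x0 a k sigma (F i)) x)|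
     <= C * t ^+ 3 * (1 + `|x|) ^+ m.
Proof.
move=> n0 g0 x00 a0 TF.
have G0 := kernelG0_gt0 rho n0 g0.
set G := kernelG rho gamma 0 in G0.
have Gn : G != 0 by rewrite gt_eqF.
have [K [m [K0 HK]]] := cir_law (G * k) (G * sigma) (mulr_ge0 (ltW G0) a0).
have TD j : exists Cm : R * nat, 0 <= Cm.1 /\ forall i x,
    `|iter j (@dirD R n) (F i) x| <= Cm.1 * (1 + `|x|) ^+ Cm.2.
  by have [C [p H]] := tame_growth (tame_iter_dirD j TF); exists (C, p).
have [c cP] := choice TD.
pose Ga := \sum_(i < n) gamma i.
have Ga0 : 0 <= Ga by rewrite sumr_ge0// => i _; exact: ltW.
(* With [r = |x|]: [Kx] bounds the displacement of the scheme, [q] bounds [1 + |A_x(z)|] over that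
   range, and [M] bounds there the line derivatives of order at most six. *)
pose Kx (r : R) := K * (1 + (x0 + Ga * r)) ^+ m.
pose q (r : R) := 1 + (r + Kx r / G).
pose M (r : R) := \sum_(j < 7) ((c j).1 * q r ^+ (c j).2 / G ^+ j).
have pbK : pb (fun _ => Kx) by rewrite /Kx; pb_tac.
have pbq : pb (fun _ => q) by rewrite /q; do 2!(apply: pbD; first by pb_tac); apply: pbM => //; exact: pb_cst.
have pbM' : pb (fun _ => M).
  apply: pb_sum => j; apply: pbM; last exact: pb_cst.
  by apply: pbM; [exact: pb_cst|exact: pbX].
have [C [p [C0 HC]]] : pb (fun _ r => 6 * (M r * Kx r)).
  by apply: pbM; [exact: pb_cst|apply: pbM].
exists C, p; split => // i d Omega P U Uu t x t0 t1 ax.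
have r0 : 0 <= `|x| by [].
have [py [y [law HE]]] := HK t (agg gamma x0 x) t0 t1 ax.
pose g := linef rho gamma x0 (F i) x.
exists (\sum_l py l * g 0%N (y l)).
  rewrite -(HE _ _ _ _ Uu); congr expectation; apply/funext => w.
  by rewrite /g /linef expr0 divr1.
have aggr : agg gamma x0 x <= x0 + Ga * `|x| := agg_le _ _ g0.
have KxB : K * (1 + agg gamma x0 x) ^+ m <= Kx `|x|.
  have Gx := mulr_ge0 Ga0 r0.
  rewrite ler_wpM2l//; apply: lerXn2r; rewrite ?nnegrE; lra.
have Kx0 : 0 <= Kx `|x| by rewrite (le_trans _ KxB)// mulr_ge0// exprn_ge0// addr_ge0.
have law' := good_law_le (ltW t0) KxB KxB law.
have gd j (z : R) : is_derive z 1 (g j) (g j.+1 z) by exact: is_derive_linef.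
have q0 : 0 <= q `|x| by rewrite /q !addr_ge0// divr_ge0// ltW.
have gM j z : (j <= 6)%N -> `|z - agg gamma x0 x| <= Kx `|x| -> `|g j z| <= M `|x|.
  move=> j6 zK; rewrite /g /linef normrM normfV (gtr0_norm (exprn_gt0 j G0)).
  apply: (@le_trans _ _ ((c j).1 * q `|x| ^+ (c j).2 / G ^+ j)).
    rewrite ler_wpM2r// ?invr_ge0 ?exprn_ge0 ?(ltW G0)//.
    apply: le_trans ((cP j).2 _ _) _; rewrite ler_wpM2l//; first exact: (cP j).1.
    apply: lerXn2r; rewrite ?nnegrE//.
    rewrite /q lerD2l; apply: le_trans (Amap_norm _ _ _ G0) _; rewrite lerD2l ler_wpM2r// invr_ge0 ltW//.
  have j7 : (j < 7)%N by [].
  rewrite /M (bigD1 (Ordinal j7))//= lerDl sumr_ge0// => l _.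
  by rewrite divr_ge0 ?mulr_ge0 ?exprn_ge0 ?(ltW G0)//; exact: (cP l).1.
have W := cir_weak_expansion (ltW t0) Kx0 gd gM law'.
have E0 : F i x = g 0%N (agg gamma x0 x).
  by rewrite /g /linef /= expr0 divr1 Amap_agg.
have E1 := L2_linef i x0 a k sigma x (agg gamma x0 x) TF Gn.
have E2 := L2_sqr_linef i x0 a k sigma x (agg gamma x0 x) TF Gn.
rewrite /= Amap_agg in E1; rewrite /= Amap_agg in E2.
rewrite E0 E1 E2; apply: le_trans W _.
have := HC t `|x| t0 t1 r0; move=> /(le_trans (ler_norm _)) H.
rewrite (_ : 6 * _ = 6 * (M `|x| * Kx `|x|) * t ^+ 3); last by ring.
by rewrite [leRHS]mulrAC ler_wpM2r// exprn_ge0// ltW.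
Qed.

(** * Linearity of the generators *)

Lemma partial_lin (R : realType) n I (F G : I -> 'rV[R]_n -> R) i (c : R) j x :
  tame F -> tame G ->
  partial j (fun x => F i x + c * G i x) x = partial j (F i) x + c * partial j (G i) x.
Proof.
move=> TF TG.
have D := is_deriveD (derivableP (@tame_derivable _ _ _ _ i j x TF))
  (is_deriveZ c (derivableP (@tame_derivable _ _ _ _ i j x TG))).
by have [_ E] := D; exact: E.
Qed.

Lemma L1_lin (R : realType) n I (F G : I -> 'rV[R]_n -> R) i (rho : 'I_n -> R) (c : R) x :
  tame F -> tame G ->
  L1 rho (fun x => F i x + c * G i x) x = L1 rho (F i) x + c * L1 rho (G i) x.
Proof.
move=> TF TG; rewrite /L1 mulrN -opprD mulr_sumr -big_split /=; congr (- _).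
by apply: eq_bigr => j _; rewrite (partial_lin i c j x TF TG); ring.
Qed.

Lemma L2_lin (R : realType) n I (F G : I -> 'rV[R]_n -> R) i (gamma : 'I_n -> R)
    (x0 a k sigma : R) (c : R) x :
  tame F -> tame G ->
  L2 gamma x0 a k sigma (fun x => F i x + c * G i x) x =
  L2 gamma x0 a k sigma (F i) x + c * L2 gamma x0 a k sigma (G i) x.
Proof.
move=> TF TG; rewrite /L2.
under eq_bigr do rewrite (partial_lin i c _ x TF TG).
rewrite big_split /= -mulr_sumr.
have alg (p q s1 s1' s2 s2' r : R) : r = s2 + c * s2' ->
    p * (s1 + c * s1') + q * r = p * s1 + q * s2 + c * (p * s1' + q * s2').
  by move=> ->; ring.
apply: alg; rewrite mulr_sumr -big_split /=; apply: eq_bigr => l _.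
rewrite mulr_sumr -big_split /=; apply: eq_bigr => j _.
rewrite -(partial_lin i c l x (tame_partial j TF) (tame_partial j TG)).
congr (partial l _ x); apply/funext => y; exact: partial_lin.
Qed.

Lemma Lgen_sqr (R : realType) n I (F : I -> 'rV[R]_n -> R) i (rho gamma : 'I_n -> R)
    (x0 a k sigma : R) x : tame F ->
  let A := L1 rho in let B := L2 gamma x0 a k sigma in
  Lgen rho gamma x0 a k sigma (Lgen rho gamma x0 a k sigma (F i)) x =
  A (A (F i)) x + A (B (F i)) x + (B (A (F i)) x + B (B (F i)) x).
Proof.
move=> TF A B.
have TA : tame (fun i => A (F i)) := tame_L1 rho TF.
have TB : tame (fun i => B (F i)) := tame_L2 gamma x0 a k sigma TF.
have E : Lgen rho gamma x0 a k sigma (F i) = (fun x => A (F i) x + 1 * B (F i) x).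
  by apply/funext => y; rewrite mul1r.
rewrite E /Lgen (L1_lin i rho 1 x TA TB) (L2_lin i gamma x0 a k sigma 1 x TA TB).
by rewrite !mul1r.
Qed.

(** * Strang splitting *)

Lemma psi1_rem1E (R : realType) n (rho : 'I_n -> R) (s : R) (f : 'rV[R]_n -> R) x :
  s != 0 -> f (psi1 rho x s) = f x + s * psi1_rem1 rho s f x.
Proof. by move=> s0; rewrite /psi1_rem1 mulrC divfK// addrC subrK. Qed.

Lemma psi1_rem2E (R : realType) n (rho : 'I_n -> R) (s : R) (f : 'rV[R]_n -> R) x :
  s != 0 -> f (psi1 rho x s) = f x + s * L1 rho f x + s ^+ 2 * psi1_rem2 rho s f x.
Proof. by move=> s0; rewrite /psi1_rem2; field. Qed.

Lemma psi1_rem3E (R : realType) n (rho : 'I_n -> R) (s : R) (f : 'rV[R]_n -> R) x :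
  s != 0 -> f (psi1 rho x s) = f x + s * L1 rho f x + s ^+ 2 / 2 * L1 rho (L1 rho f) x +
    s ^+ 3 * psi1_rem3 rho s f x.
Proof. by move=> s0; rewrite /psi1_rem3; field. Qed.

(** The half steps on either side contribute [t s (baf + abf)], and [t s = t^2 / 2] is exactly the
    weight of the two cross terms of the squared generator. The factor 1/4 is
    [t s^2 = t^2 s / 2 = t^3 / 4]. *)
Lemma strang_algebra (R : realType) (s t f af bf aaf abf baf bbf r3 u2 u3 u4 u5 u6 : R) :
  t = 2 * s ->
  f + t * af + t ^+ 2 / 2 * aaf + t ^+ 3 * r3 +
  t * (bf + s * baf + s ^+ 2 * u2 + s * (abf + s * u3) + s ^+ 2 * u4) +
  t ^+ 2 / 2 * (bbf + s * u5 + s * u6) -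
  (f + t * (af + bf) + t ^+ 2 / 2 * (aaf + abf + (baf + bbf))) =
  t ^+ 3 * (r3 + 1 / 4 * (u2 + (u3 + (u4 + (u5 + u6))))).
Proof. by move=> ->; field. Qed.

(** Each flow is expanded only as far as its prefactor requires. The term free of [L2] is a single
    flow over the full step and needs the third remainder; the term in [t] needs second remainders
    on both sides, and the term in [t^2] first ones. *)
Lemma strang_expansion (R : realType) n I (F : I -> 'rV[R]_n -> R) (h : I -> R)
    (rho gamma : 'I_n -> R) (x0 a k sigma : R) :
  (forall i, 0 <= rho i) -> (forall i, 0 < h i) -> tame F ->
  let A := L1 rho in let B := L2 gamma x0 a k sigma in
  let L := Lgen rho gamma x0 a k sigma in
  let F2 i x := F i (psi1 rho x (h i)) in
  exists C m, 0 <= C /\ forall i x t z, t = 2 * h i -> z = psi1 rho x (h i) ->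
    `|(F2 i z + t * B (F2 i) z + t ^+ 2 / 2 * B (B (F2 i)) z) -
      (F i x + t * L (F i) x + t ^+ 2 / 2 * L (L (F i)) x)| <= C * t ^+ 3 * (1 + `|x|) ^+ m.
Proof.
move=> r0 h0 TF A B L F2.
have TA G : tame G -> tame (fun i : I => A (G i)) by exact: tame_L1.
have TB G : tame G -> tame (fun i : I => B (G i)) by exact: tame_L2.
have TF2 : tame F2 := tame_psi1 r0 (fun i => ltW (h0 i)) TF.
pose R1 G i := psi1_rem1 rho (h i) (G i).
pose R2 G i := psi1_rem2 rho (h i) (G i).
have T1 G : tame G -> tame (R1 G) by exact: tame_psi1_rem1.
have T2 G : tame G -> tame (R2 G) by exact: tame_psi1_rem2.
pose BF2 i := B (F2 i); pose BBF2 i := B (B (F2 i)).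
have TBF2 : tame BF2 := TB _ TF2.
have TBBF2 : tame BBF2 := TB _ TBF2.
have h20 i : 0 < 2 * h i by rewrite mulr_gt0.
have q4 : @tame R n I (fun _ _ => 1 / 4) := tame_cst_fun _ _ (1 / 4).
have G3 := psi1_rem3_growth r0 h20 TF.
have Gr : growth (fun i x => 1 / 4 * (B (R2 F i) x + (A (B (R1 F i)) x + (R2 BF2 i x +
    (B (B (R1 F i)) x + R1 BBF2 i x))))).
  apply: tame_growth; apply: tameM => //.
  apply: tameD; first exact: (TB _ (T2 _ TF)).
  apply: tameD; first exact: (TA _ (TB _ (T1 _ TF))).
  apply: tameD; first exact: T2.
  by apply: tameD; [exact: (TB _ (TB _ (T1 _ TF)))|exact: T1].
have [C [m [C0 H]]] := growthD G3 Gr.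
exists C, m; split => // i x t z tE zE.
have hn : h i != 0 by rewrite gt_eqF.
have tn : t != 0 by rewrite tE gt_eqF.
have t3 : 0 <= t ^+ 3 by rewrite exprn_ge0// tE ltW.
have e1 : F2 i = (fun y => F i y + h i * R1 F i y).
  by apply/funext => y; exact: psi1_rem1E.
have e2 : F2 i = (fun y => (F i y + h i * A (F i) y) + h i ^+ 2 * R2 F i y).
  by apply/funext => y; exact: psi1_rem2E.
have TAF := TA _ TF; have TR1 := T1 _ TF; have TR2 := T2 _ TF.
have TBF := TB _ TF; have TBR1 := TB _ TR1.
(* The index is frozen because [h] may be unbounded. *)
have Ta : tame (fun (_ : unit) y => F i y + h i * A (F i) y).
  pose fr (_ : unit) := i.
  exact: (tameD (tame_reindex fr TF) (tameM (tame_cst_fun n unit (h i)) (tame_reindex fr TAF))).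
have TR2' : tame (fun _ : unit => R2 F i) := tame_reindex (fun _ : unit => i) TR2.
have b1 : B (F2 i) = (fun y => B (F i) y + h i * B (R1 F i) y).
  by apply/funext => y; rewrite e1; exact: (L2_lin i gamma x0 a k sigma (h i) y TF TR1).
have b2 y : B (F2 i) y = B (F i) y + h i * B (A (F i)) y + h i ^+ 2 * B (R2 F i) y.
  rewrite e2; apply: (etrans (L2_lin tt gamma x0 a k sigma (h i ^+ 2) y Ta TR2')).
  by congr (_ + _); exact: (L2_lin i gamma x0 a k sigma (h i) y TF TAF).
have bb y : B (B (F2 i)) y = B (B (F i)) y + h i * B (B (R1 F i)) y.
  by rewrite b1; exact: (L2_lin i gamma x0 a k sigma (h i) y TBF TBR1).
have ab y : A (B (F2 i)) y = A (B (F i)) y + h i * A (B (R1 F i)) y.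
  by rewrite b1; exact: (L1_lin i rho (h i) y TBF TBR1).
have z0 : F2 i z = F i x + t * A (F i) x + t ^+ 2 / 2 * A (A (F i)) x +
    t ^+ 3 * psi1_rem3 rho t (F i) x.
  by rewrite /F2 zE psi1_add (_ : h i + h i = t) ?psi1_rem3E// tE; ring.
have z1 : B (F2 i) z = B (F2 i) x + h i * A (B (F2 i)) x + h i ^+ 2 * R2 BF2 i x.
  by rewrite zE; exact: psi1_rem2E.
have z2 : B (B (F2 i)) z = B (B (F2 i)) x + h i * R1 BBF2 i x.
  by rewrite zE; exact: psi1_rem1E.
have LL : L (L (F i)) x = A (A (F i)) x + A (B (F i)) x + (B (A (F i)) x + B (B (F i)) x).
  exact: (Lgen_sqr i rho gamma x0 a k sigma x TF).
have LE : L (F i) x = A (F i) x + B (F i) x by [].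
have Hx := H i x; rewrite -tE in Hx.
rewrite z0 z1 z2 ab b2 bb LL LE.
rewrite (strang_algebra _ _ _ _ _ _ _ _ _ _ _ _ _ tE).
by rewrite normrM (ger0_norm t3) [leRHS]mulrAC [leRHS]mulrC ler_wpM2l.
Qed.

Lemma Psi_weak (R : realType) n I (F : I -> 'rV[R]_n -> R) (rho gamma : 'I_n -> R)
    (x0 a k sigma : R) :
  (0 < n)%N -> (forall i, 0 <= rho i) -> (forall i, 0 < gamma i) -> 0 <= x0 -> 0 <= a ->
  tame F ->
  exists C m, 0 <= C /\
    forall i (d : measure_display) (Omega : measurableType d)
      (P : probability Omega R) (U : {RV P >-> R}), uniform01 U ->
    forall t x, 0 < t -> t <= 1 -> coneC rho gamma x0 x ->
    exists2 e : R, 'E_P[(fun w => F i (Psi rho gamma x0 a k sigma x t (U w)))]%E = e%:E &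
     `|e - (F i x + t * Lgen rho gamma x0 a k sigma (F i) x +
        t ^+ 2 / 2 * Lgen rho gamma x0 a k sigma (Lgen rho gamma x0 a k sigma (F i)) x)|
     <= C * t ^+ 3 * (1 + `|x|) ^+ m.
Proof.
move=> n0 r0 g0 x00 a0 TF.
(* Half steps become part of the index, so that the estimate for [psi2], applied to [F i] composed
   with the flow, has constants independent of [t]. *)
pose J := (I * {t : R | 0 < t})%type.
pose h (j : J) : R := sval j.2.
have h0 j : 0 < h j := svalP j.2.
have TJ : tame (fun j : J => F j.1) := tame_reindex (fun j : J => j.1) TF.
have [C [m [C0 HC]]] := strang_expansion gamma x0 a k sigma r0 h0 TJ.
have T2 := tame_psi1 r0 (fun j => ltW (h0 j)) TJ.
have [D [p [D0 HD]]] := psi2_weak rho k sigma n0 g0 x00 a0 T2.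
exists (C + D), (m + p)%N; split; first exact: addr_ge0.
move=> i d Omega P U Uu t x t0 t1 cx.
have th0 : 0 < t / 2 by rewrite divr_gt0.
pose j : J := (i, exist _ (t / 2) th0).
have hj : h j = t / 2 by [].
have t2 : 2 * h j = t by rewrite hj; field.
pose z := psi1 rho x (t / 2).
(* The condition defining the cone, read at time [t / 2], is the nonnegativity of the aggregate
   after the first half step. *)
have az : 0 <= agg gamma x0 z.
  have := cx (t / 2) (ltW th0); rewrite /agg.
  rewrite (eq_bigr (fun i => gamma i * z 0 i))// => l _.
  by rewrite mxE mulrA mulrAC.
have [e Ee He] := HD j d Omega P U Uu t z t0 t1 az.
exists e; first by rewrite -Ee.
have Hj := HC j x t z (esym t2) erefl.
have zx : `|z| <= `|x| by apply: psi1_norm => //; exact: ltW.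
have w1 : 1 <= 1 + `|x| by rewrite lerDl.
have t3 : 0 <= t ^+ 3 by rewrite exprn_ge0// ltW.
apply: le_trans (le_trans (ler_distD _ _ _) (lerD He Hj)) _.
rewrite [leRHS](_ : _ = D * t ^+ 3 * (1 + `|x|) ^+ (m + p) + C * t ^+ 3 * (1 + `|x|) ^+ (m + p));
  last by ring.
apply: lerD; apply: ler_wpM2l; rewrite ?(mulr_ge0 _ t3)//.
  apply: (@le_trans _ _ ((1 + `|x|) ^+ p)).
    by apply: lerXn2r; rewrite ?nnegrE// lerD2l.
  by rewrite ler_weXn2l// leq_addl.
by rewrite ler_weXn2l// leq_addr.
Qed.

(** Returns from the sup norm to the Euclidean one; the exponent [m + 1] is positive even for
    [m = 0], as required of [E]. *)
Lemma add_pow_powR (R : realType) n (x : 'rV[R]_n) m :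
  (1 + `|x|) ^+ m <= 2 ^+ m.+1 * (1 + enorm x `^ m.+1%:R).
Proof.
have e0 := enorm_ge0 x.
rewrite powR_mulrn//.
apply: (@le_trans _ _ ((1 + enorm x) ^+ m.+1)).
  apply: (@le_trans _ _ ((1 + enorm x) ^+ m)).
    by apply: lerXn2r; rewrite ?nnegrE ?addr_ge0// lerD2l norm_le_enorm.
  by rewrite ler_weXn2l// lerDl.
have [x1|x1] := leP (enorm x) 1.
  apply: (@le_trans _ _ (2 ^+ m.+1)).
    by apply: lerXn2r; rewrite ?nnegrE ?addr_ge0//; lra.
  by rewrite ler_peMr ?exprn_ge0// lerDl exprn_ge0.
apply: (@le_trans _ _ (2 ^+ m.+1 * enorm x ^+ m.+1)).
  by rewrite -exprMn; apply: lerXn2r; rewrite ?nnegrE ?addr_ge0 ?mulr_ge0//; lra.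
by rewrite ler_wpM2l ?exprn_ge0// lerDr.
Qed.

Lemma second_order_scheme_intro (R : realType) n (D : set 'rV[R]_n)
    (S : 'rV[R]_n -> R -> R -> 'rV[R]_n) (M : ('rV[R]_n -> R) -> ('rV[R]_n -> R)) :
  (forall I (F : I -> 'rV[R]_n -> R), tame F -> exists C m, 0 <= C /\
    forall i (d : measure_display) (Omega : measurableType d)
      (P : probability Omega R) (U : {RV P >-> R}), uniform01 U ->
    forall t x, 0 < t -> t <= 1 -> D x ->
    exists2 e : R, 'E_P[(fun w => F i (S x t (U w)))]%E = e%:E &
     `|e - (F i x + t * M (F i) x + t ^+ 2 / 2 * M (M (F i)) x)|
     <= C * t ^+ 3 * (1 + `|x|) ^+ m) ->
  second_order_scheme D S M.
Proof.
move=> H Cf ef.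
have [C [m [C0 HC]]] := H _ _ (tame_good_class Cf ef).
(* [C] is only known to be nonnegative, and [C + 1] is positive. *)
exists ((C + 1) * 2 ^+ m.+1), m.+1%:R, 1; split => //.
  by rewrite mulr_gt0 ?exprn_gt0// ltr_wpDl.
move=> f cf gf d Omega P U Uu t x t0 t1 Dx.
have [e -> He] := HC (exist _ f (conj cf gf)) d Omega P U Uu t x t0 (ltW t1) Dx.
rewrite -EFinB abse_EFin lee_fin; apply: le_trans He _ => /=.
have t3 : 0 <= t ^+ 3 by rewrite exprn_ge0// ltW.
rewrite (_ : (C + 1) * 2 ^+ m.+1 * t ^+ 3 * (1 + enorm x `^ m.+1%:R) =
  (C + 1) * t ^+ 3 * (2 ^+ m.+1 * (1 + enorm x `^ m.+1%:R))); last by ring.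
apply: ler_pM; [exact: mulr_ge0|by rewrite exprn_ge0// addr_ge0| |exact: add_pow_powR].
by rewrite ler_wpM2r// lerDl.
Qed.

Theorem proposition4p6 (R : realType) (n : nat) (rho gamma : 'I_n -> R)
    (x0 a k sigma : R)
    (hn : (0 < n)%N)
    (hrho0 : forall i : 'I_n, 0 <= rho i)
    (hrho : forall i j : 'I_n, (i < j)%N -> rho i < rho j)
    (hgamma : forall i : 'I_n, 0 < gamma i)
    (hx0 : 0 <= x0) (ha : 0 <= a) (hsigma : 0 < sigma) :
  second_order_scheme
    [set x : 'rV[R]_n | 0 <= agg gamma x0 x]
    (psi2 rho gamma x0 a k sigma)
    (L2 gamma x0 a k sigma)
  /\
  second_order_scheme
    (coneC rho gamma x0)
    (Psi rho gamma x0 a k sigma)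
    (Lgen rho gamma x0 a k sigma).
Proof.
split; apply: second_order_scheme_intro => I F TF.
  exact: psi2_weak.
exact: Psi_weak.
Qed.
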